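(* For every $1\leq p<\infty$, $L^p(\mathbb R^{\mathbb N},\mathcal B_\infty,\mu)\cong \ell^p(\mathfrak c,L^p[0,1])$, i.e. the two spaces are isometrically isomorphic.
   Context: Let $\mathcal B$ be the Borel $\sigma$-algebra of $\mathbb R$, $\lambda$ the usual Lebesgue measure on $(\mathbb R,\mathcal B)$, and $\mathcal B_\infty$ the Borel $\sigma$-algebra of $\mathbb R^{\mathbb N}$ with the product topology. Let $\mathcal F(\mathcal B,\lambda)$ be the family of all rectangles $R=\prod_{n\in\mathbb N}A_n\subset\mathbb R^{\mathbb N}$ with $A_n\in\mathcal B$, $\lambda(A_n)<\infty$ for every $n$, and $\prod_{n\in\mathbb N}\lambda(A_n)\in[0,\infty)$ (infinite product as limit of partial products); put $\operatorname{vol}(R):=\prod_{n\in\mathbb N}\lambda(A_n)$. For $E\subset\mathbb R^{\mathbb N}$ define the outer measure $\mu^*(E):=\inf\{\sum_{k=1}^\infty \operatorname{vol}(R_k): E\subset\bigcup_{k=1}^\infty R_k,\ R_k\in\mathcal F(\mathcal B,\lambda)\}$ with $\inf\varnothing=\infty$, and let $\mu:=\mu^*|_{\mathcal B_\infty}$. This is Baker's measure: a translation invariant measure on $\mathcal B_\infty$ with $\mu(R)=\operatorname{vol}(R)$ for every $R\in\mathcal F(\mathcal B,\lambda)$. For a Banach space $X$ and a set $J$, $\ell^p(J,X)$ is the space of families $(x_j)_{j\in J}$ in $X$ with $\sum_{j\in J}\|x_j\|^p<\infty$, normed by $(\sum_{j\in J}\|x_j\|^p)^{1/p}$. $\mathfrak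 c$ denotes the cardinality of the continuum (and $\ell^p(\mathfrak c,X)$ means $\ell^p(J,X)$ with $|J|=\mathfrak c$). $L^p[0,1]$ is with respect to Lebesgue measure. $\cong$ denotes (linear) isometric isomorphism. *)

(* Defs.v *)
From HB Require Import structures.
From mathcomp Require Import all_boot all_order all_algebra generic_quotient.
From mathcomp Require Import all_classical all_reals all_analysis.
From mathcomp Require Import measurable_realfun ess_sup_inf ring.
Set Implicit Arguments.
Unset Strict Implicit.
Unset Printing Implicit Defensive.
Import Order.TTheory GRing.Theory Num.Theory.
Import numFieldNormedType.Exports.
Local Open Scope classical_set_scope.
Local Open Scope ring_scope.

(* [LspaceType mu p1] comes without algebraic structure: it is given here the
   vector space structure of the quotient of [LfunType mu p1] by equality almost
   everywhere, normed by [Lnorm]. *)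
Section Lspace_class.
Context d (T : measurableType d) (R : realType).
Variables (mu : {measure set T -> \bar R}) (p : \bar R) (p1 : (1 <= p)%E).
Local Notation Lp := (LspaceType mu p1).
Local Notation Lf := (LfunType mu p1).

Lemma ae_eq_Lnorm (f g : {mfun T >-> R}) : f = g %[ae mu] ->
  ('N[mu]_p[EFin \o f] = 'N[mu]_p[EFin \o g])%E.
Proof.
move=> fg; rewrite unlock; case: p p1 => [r r1|_|]; last by [].
- have mr (h : {mfun T >-> R}) :
      measurable_fun [set: T] (fun x => `|(EFin \o h) x| `^ r)%E.
    apply: (@measurableT_comp _ _ _ _ _ _ (fun x => x `^ r)%E) => //.
      exact: (measurableT_comp (measurable_poweR _)).
    have mh : measurable_fun [set: T] (EFin \o h) by exact/measurable_EFinP.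
    exact: (measurableT_comp (@abse_measurable R setT)).
  congr poweR; apply: ge0_ae_eq_integral => //.
  1,2: by move=> x _; exact: poweR_ge0.
  by apply: filterS fg => x /= + _ => /(_ I) ->.
- case: ifPn => // _; apply: eq_ess_sup.
  by apply: filterS fg => x /= /(_ I) ->.
Qed.

(* [LspaceType] quotients functions valued in [measurableTypeR R], which has the
   same carrier and measurable sets as [R] but not the same display; the two
   conversions below bridge [LfunType] and [LspaceType]. *)
Local Notation quo := (@aeEqMfun _ _ R T (measurableTypeR R) mu).

Definition mfun_toTR (f : T -> R) (mf : measurable_fun setT f) :
    {mfun T >-> measurableTypeR R} :=
  HB.pack f (@isMeasurableFun.Build _ _ T (measurableTypeR R) f mf).

Definition mfun_ofTR (f : T -> R)
    (mf : @measurable_fun _ _ T (measurableTypeR R) setT f) :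
    {mfun T >-> R} :=
  HB.pack f (@isMeasurableFun.Build _ _ T R f mf).

Lemma repr_pi_ae (f : {mfun T >-> measurableTypeR R}) :
  (repr (\pi_quo%qT f) : T -> R) = f %[ae mu].
Proof.
have /eqquotP := reprK (\pi_quo%qT f).
by move=> /asboolP.
Qed.

Definition lp_mfun (f : Lp) : {mfun T >-> R} :=
  mfun_ofTR (@measurable_funPT _ _ _ _ (repr (f : quo))).

Lemma lp_finite (f : Lp) : finite_norm mu p (lp_mfun f).
Proof. exact: (@Lebesgue_finite _ _ _ _ _ _ f). Qed.

Lemma lp_repr_subproof (f : Lp) : (repr (f : quo) : T -> R) \in Lfun mu p.
Proof.
apply/andP; split; rewrite inE/=; last exact: lp_finite.
exact: (@measurable_funPT _ _ _ _ (repr (f : quo))).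
Qed.

Definition lp_repr (f : Lp) : Lf := Lfun_Sub p1 (lp_repr_subproof f).

Definition lf_quo (f : Lf) : quo :=
  (\pi_quo (mfun_toTR (@measurable_funPT _ _ _ _ f)))%qT.

Lemma lf_quo_finite (f : Lf) : finite_norm mu p (lf_quo f : T -> R).
Proof.
rewrite /finite_norm.
rewrite -[X in EFin \o X]/(mfun_ofTR (@measurable_funPT _ _ _ _ (repr (lf_quo f))) : T -> R).
rewrite (@ae_eq_Lnorm _ f); last exact: repr_pi_ae.
exact: Lfunction_finite.
Qed.

Definition lp_class (f : Lf) : Lp :=
  HB.pack (lf_quo f) (@isFinLebesgue.Build _ _ _ mu p p1 (lf_quo f) (lf_quo_finite f)).

Lemma lp_classK (f : Lf) : lp_repr (lp_class f) = f %[ae mu].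
Proof. exact: repr_pi_ae. Qed.

Lemma lp_eqP (f g : Lp) : f = g <-> lp_repr f = lp_repr g %[ae mu].
Proof.
split=> [->|]; first exact: ae_eq_refl.
case: f g => [f [[Pf]]] [g [[Pg]]] /= fg.
have fgE : f = g.
  by rewrite -[f]reprK -[g]reprK; apply/eqquotP/asboolP.
subst g; by rewrite (Prop_irrelevance Pf Pg).
Qed.
Lemma lp_reprK (f : Lp) : lp_class (lp_repr f) = f.
Proof. exact/lp_eqP/lp_classK. Qed.

Lemma lp_class_eq (f g : Lf) : f = g %[ae mu] -> lp_class f = lp_class g.
Proof.
move=> fg; apply/lp_eqP.
by apply: filterS3 fg (lp_classK f) (lp_classK g) => x /= + + + _ =>
  /(_ I) -> /(_ I) -> /(_ I) ->.
Qed.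

HB.instance Definition _ := gen_eqMixin Lp.
HB.instance Definition _ := gen_choiceMixin Lp.

Let lp_zero : Lp := lp_class 0.
Let lp_opp (f : Lp) : Lp := lp_class (- lp_repr f).
Let lp_add (f g : Lp) : Lp := lp_class (lp_repr f + lp_repr g).
Let lp_scale (a : R) (f : Lp) : Lp := lp_class (a *: lp_repr f).

Let lp_addE (f g : Lf) : lp_add (lp_class f) (lp_class g) = lp_class (f + g).
Proof.
apply: lp_class_eq; apply: filterS2 (lp_classK f) (lp_classK g) => x /= + + _.
by move=> /(_ I) fx /(_ I) gx; congr (_ + _).
Qed.

Let lp_oppE (f : Lf) : lp_opp (lp_class f) = lp_class (- f).
Proof.
apply: lp_class_eq; apply: filterS (lp_classK f) => x /= + _.
by move=> /(_ I) fx; congr (- _).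
Qed.

Let lp_scaleE a (f : Lf) : lp_scale a (lp_class f) = lp_class (a *: f).
Proof.
apply: lp_class_eq; apply: filterS (lp_classK f) => x /= + _.
by move=> /(_ I) fx; congr (_ * _).
Qed.

Let lp_ind (P : Lp -> Prop) : (forall f, P (lp_class f)) -> forall f, P f.
Proof. by move=> Pc f; rewrite -(lp_reprK f). Qed.

Let lp_addA : associative lp_add.
Proof.
elim/lp_ind => f; elim/lp_ind => g; elim/lp_ind => h.
by rewrite !lp_addE addrA.
Qed.

Let lp_addC : commutative lp_add.
Proof.
by elim/lp_ind => f; elim/lp_ind => g; rewrite !lp_addE addrC.
Qed.

Let lp_add0 : left_id lp_zero lp_add.
Proof. by elim/lp_ind => f; rewrite lp_addE add0r. Qed.

Let lp_addN : left_inverse lp_zero lp_opp lp_add.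
Proof. by elim/lp_ind => f; rewrite lp_oppE lp_addE addNr. Qed.

HB.instance Definition _ :=
  GRing.isZmodule.Build Lp lp_addA lp_addC lp_add0 lp_addN.

Lemma lp_classD (f g : Lf) : lp_class (f + g) = lp_class f + lp_class g.
Proof. by rewrite -lp_addE. Qed.

Let lp_scaleA a b f : lp_scale a (lp_scale b f) = lp_scale (a * b) f.
Proof. by elim/lp_ind: f => f; rewrite !lp_scaleE scalerA. Qed.

Let lp_scale1 : left_id 1 lp_scale.
Proof. by elim/lp_ind => f; rewrite lp_scaleE scale1r. Qed.

Let lp_scaleDr : right_distributive lp_scale +%R.
Proof.
move=> a; elim/lp_ind => f; elim/lp_ind => g.
by rewrite -lp_classD !lp_scaleE scalerDr lp_classD.
Qed.

Let lp_scaleDl f : {morph lp_scale^~ f : a b / a + b}.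
Proof.
by move=> a b; elim/lp_ind: f => f; rewrite !lp_scaleE scalerDl lp_classD.
Qed.

HB.instance Definition _ := GRing.Zmodule_isLmodule.Build R Lp
  lp_scaleA lp_scale1 lp_scaleDr lp_scaleDl.

Lemma lp_classZ a (f : Lf) : lp_class (a *: f) = a *: lp_class f.
Proof. by rewrite -lp_scaleE. Qed.

Let lp_norm (f : Lp) : R := fine 'N[mu]_p[EFin \o (f : T -> R)]%E.

Let lp_normE (f : Lf) : (lp_norm (lp_class f))%:E = 'N[mu]_p[EFin \o f]%E.
Proof.
rewrite -(ae_eq_Lnorm (lp_classK f)).
exact: (finite_norm_fine (lp_repr (lp_class f))).
Qed.

Let lp_normD (f g : Lp) : lp_norm (f + g) <= lp_norm f + lp_norm g.
Proof.
elim/lp_ind: f => f; elim/lp_ind: g => g; rewrite -lp_classD.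
by rewrite -lee_fin EFinD !lp_normE eminkowski.
Qed.

Let lp_normZ a (f : Lp) : lp_norm (a *: f) = `|a| * lp_norm f.
Proof.
elim/lp_ind: f => f; rewrite -lp_classZ.
by apply: EFin_inj; rewrite EFinM !lp_normE; exact: LnormZ.
Qed.

Let lp_norm0_eq0 (f : Lp) : lp_norm f = 0 -> f = 0.
Proof.
elim/lp_ind: f => f Nf0; have {Nf0} := congr1 EFin Nf0; rewrite lp_normE => Nf0.
by apply: lp_class_eq; apply: (@fine_Lnormr_eq0 _ _ _ mu p p1); rewrite Nf0.
Qed.

HB.instance Definition _ :=
  Lmodule_isNormed.Build R Lp lp_normD lp_normZ lp_norm0_eq0.

Lemma lp_normrE (f : Lp) : `|f| = fine 'N[mu]_p[EFin \o (f : T -> R)]%E.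
Proof. by []. Qed.

End Lspace_class.

Section ellp.
Context (R : realType) (p : R) (J : choiceType) (X : normedModType R).
Implicit Types (x y : J -> X).

Definition pow_sum x : \bar R := \esum_(j in [set: J]) (`|x j| `^ p)%:E.

Definition ellp_pred : {pred J -> X} := mem [set x | (pow_sum x < +oo)%E].

(* [p1] is not used by the carrier; it is recorded in the type so that the normed
   structure can be inferred. *)
Record ellp (p1 : (1 <= p%:E)%E) := Ellp {
  ellp_fun :> J -> X ;
  _ : ellp_fun \in ellp_pred }.

Variable p1 : (1 <= p%:E)%E.

HB.instance Definition _ := [isSub for @ellp_fun p1].
HB.instance Definition _ := [Choice of ellp p1 by <:].

Let p_ge1 : 1 <= p. Proof. by rewrite -lee_fin. Qed.
Let p_gt0 : 0 < p. Proof. exact: lt_le_trans p_ge1. Qed.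
Let p_neq0 : p != 0. Proof. by rewrite gt_eqF. Qed.

Lemma pow_sum_ge0 x : (0 <= pow_sum x)%E.
Proof. by apply: esum_ge0 => j _; rewrite lee_fin powR_ge0. Qed.

Lemma esumZ_le (c : R) (F : J -> \bar R) : 0 <= c -> (forall j, 0 <= F j)%E ->
  (\esum_(j in [set: J]) (c%:E * F j) <= c%:E * \esum_(j in [set: J]) F j)%E.
Proof.
move=> c0 F0; apply: ge_ereal_sup => _ [A Afin <-].
rewrite -ge0_mule_fsumr//; apply: lee_wpmul2l; first by rewrite lee_fin.
by apply: ereal_sup_ubound; exists A.
Qed.

Lemma pow_sumZ_le a x : (pow_sum (a *: x) <= (`|a| `^ p)%:E * pow_sum x)%E.
Proof.
apply: (@le_trans _ _
    (\esum_(j in [set: J]) ((`|a| `^ p)%:E * (`|x j| `^ p)%:E)%E)); last first.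
  by apply: esumZ_le => [|j]; rewrite ?lee_fin powR_ge0.
apply: le_esum => j _.
by rewrite -EFinM -powRM// lee_fin /= normrZ.
Qed.

Lemma powR_normD_le (a b : R) (u v : X) : 0 < a -> 0 < b ->
  `|u + v| `^ p <= (a + b) `^ p *
    (a / (a + b) * (a^-1 `^ p * `|u| `^ p) + b / (a + b) * (b^-1 `^ p * `|v| `^ p)).
Proof.
move=> a0 b0; have ab0 : 0 < a + b by exact: addr_gt0.
have t0 : 0 <= a / (a + b) by rewrite divr_ge0 ?ltW.
have t1 : a / (a + b) <= 1 by rewrite ler_pdivrMr// mul1r lerDl ltW.
rewrite -!powRM ?invr_ge0 ?(ltW a0) ?(ltW b0)//.
have -> : b / (a + b) = 1 - a / (a + b).
  by rewrite -[in RHS](divff (lt0r_neq0 ab0)) -mulrBl (addrC a) addrK.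
have := @convex_powR _ _ p_ge1 (Itv01 t0 t1) (a^-1 * `|u|) (b^-1 * `|v|).
rewrite !inE/= !in_itv/= !mulr_ge0 ?invr_ge0 ?(ltW a0) ?(ltW b0)// => /(_ isT isT).
rewrite !convRE /= /unstable.onem => /(ler_wpM2l (powR_ge0 (a + b) p)).
apply: le_trans.
have E : (a + b) * (a / (a + b) * (a^-1 * `|u|) + (1 - a / (a + b)) * (b^-1 * `|v|)) = `|u| + `|v|.
  by field; rewrite !lt0r_neq0.
rewrite -powRM ?(ltW ab0)//; last first.
  by apply: addr_ge0; apply: mulr_ge0; rewrite ?subr_ge0// mulr_ge0// invr_ge0 ltW.
rewrite E; apply: ge0_ler_powR; rewrite ?(ltW p_gt0) ?nnegrE ?addr_ge0//.
exact: ler_normD.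
Qed.

Lemma pow_sumD_le (a b : R) x y : 0 < a -> 0 < b ->
  (pow_sum (x + y)%R <= ((a + b) `^ p)%:E *
    ((a / (a + b) * a^-1 `^ p)%:E * pow_sum x +
     (b / (a + b) * b^-1 `^ p)%:E * pow_sum y))%E.
Proof.
move=> a0 b0; have ab0 : 0 < a + b by exact: addr_gt0.
pose c := a / (a + b) * a^-1 `^ p; pose d := b / (a + b) * b^-1 `^ p.
have c0 : 0 <= c by rewrite !mulr_ge0 ?powR_ge0 ?invr_ge0 ?ltW.
have d0 : 0 <= d by rewrite !mulr_ge0 ?powR_ge0 ?invr_ge0 ?ltW.
have pow0 (z : J -> X) j : (0 <= (`|z j| `^ p)%:E)%E by rewrite lee_fin powR_ge0.
apply: (@le_trans _ _ (\esum_(j in [set: J]) (((a + b) `^ p)%:E *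
   (c%:E * (`|x j| `^ p)%:E + d%:E * (`|y j| `^ p)%:E)))%E).
  apply: le_esum => j _; rewrite -(EFinM c) -(EFinM d) -EFinD -EFinM lee_fin.
  by apply: le_trans (powR_normD_le (x j) (y j) a0 b0) _; rewrite /c /d !mulrA.
have cx0 j : (0 <= c%:E * (`|x j| `^ p)%:E)%E by rewrite mule_ge0.
have dy0 j : (0 <= d%:E * (`|y j| `^ p)%:E)%E by rewrite mule_ge0.
apply: le_trans.
  by apply: esumZ_le => [|j]; rewrite ?powR_ge0// adde_ge0.
apply: lee_wpmul2l; first by rewrite lee_fin powR_ge0.
by rewrite esumD//; apply: leeD; exact: esumZ_le.
Qed.

Lemma ellp_submod_closed : submod_closed ellp_pred.
Proof.
split.
  rewrite inE/= /pow_sum esum1// => j _.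
  by rewrite normr0 powR0.
move=> a x y; rewrite !inE/= => xoo yoo.
apply: le_lt_trans (pow_sumD_le (a *: x) y ltr01 ltr01) _.
rewrite lte_mul_pinfty ?lee_fin ?powR_ge0//.
rewrite lte_add_pinfty// lte_mul_pinfty ?lee_fin ?mulr_ge0 ?powR_ge0 ?invr_ge0//.
apply: le_lt_trans (pow_sumZ_le a x) _.
by rewrite lte_mul_pinfty ?lee_fin ?powR_ge0.
Qed.

HB.instance Definition _ := GRing.isSubmodClosed.Build R (J -> X) ellp_pred
  ellp_submod_closed.
HB.instance Definition _ := [SubChoice_isSubLmodule of ellp p1 by <:].

Definition ellp_norm (x : ellp p1) : R := fine (pow_sum x) `^ p^-1.

Lemma pow_sum_fin (x : ellp p1) : pow_sum x \is a fin_num.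
Proof.
rewrite ge0_fin_numE ?pow_sum_ge0//.
by have := valP x; rewrite inE.
Qed.

Lemma pow_sumE (x : ellp p1) : pow_sum x = (ellp_norm x `^ p)%:E.
Proof.
rewrite /ellp_norm -powRrM mulVf// powRr1 ?fine_ge0 ?pow_sum_ge0//.
by rewrite fineK ?pow_sum_fin.
Qed.

Lemma ellp_norm_ge0 (x : ellp p1) : 0 <= ellp_norm x. Proof. exact: powR_ge0. Qed.

Lemma ellp_norm_le (x : ellp p1) (r : R) : 0 <= r ->
  (pow_sum x <= (r `^ p)%:E)%E -> ellp_norm x <= r.
Proof.
move=> r0; rewrite pow_sumE lee_fin => h.
have := ellp_norm_ge0 x; move: (ellp_norm x) h => s h s0.
have pV0 : 0 <= p^-1 by rewrite invr_ge0 ltW.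
have := @ge0_ler_powR _ _ pV0 (s `^ p) (r `^ p).
rewrite !nnegrE !powR_ge0 => /(_ isT isT h).
by rewrite -!powRrM mulfV// !powRr1.
Qed.

Lemma ellp_norm0_eq0 (x : ellp p1) : ellp_norm x = 0 -> x = 0.
Proof.
move=> x0; have : pow_sum x = 0%E by rewrite pow_sumE x0 powR0.
move=> sx; apply/val_inj/funext => j.
have : ((`|x j| `^ p)%:E <= 0)%E.
  rewrite -sx; apply: esum_ge; exists [set j]; last by rewrite fsbig_set1.
  by split => //; exact: finite_set1.
rewrite lee_fin => h; apply/normr0_eq0/(@powR_eq0_eq0 _ _ p)/eqP.
by rewrite eq_le h powR_ge0.
Qed.

Lemma ellp_normZ a (x : ellp p1) : ellp_norm (a *: x) = `|a| * ellp_norm x.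
Proof.
have le b (y : ellp p1) : ellp_norm (b *: y) <= `|b| * ellp_norm y.
  apply: ellp_norm_le; first by rewrite mulr_ge0 ?ellp_norm_ge0.
  by rewrite powRM ?ellp_norm_ge0// EFinM -pow_sumE; exact: pow_sumZ_le.
apply/eqP; rewrite eq_le le/=.
have [->|a0] := eqVneq a 0; first by rewrite normr0 mul0r ellp_norm_ge0.
have := le a^-1 (a *: x).
by rewrite scalerA mulVf// scale1r normfV ler_pdivlMl ?normr_gt0.
Qed.

Lemma ellp_normD (x y : ellp p1) :
  ellp_norm (x + y) <= ellp_norm x + ellp_norm y.
Proof.
have [/ellp_norm0_eq0 ->|x0] := eqVneq (ellp_norm x) 0.
  by rewrite add0r lerDr ellp_norm_ge0.
have [/ellp_norm0_eq0 ->|y0] := eqVneq (ellp_norm y) 0.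
  by rewrite addr0 lerDl ellp_norm_ge0.
have {}x0 : 0 < ellp_norm x by rewrite lt_neqAle eq_sym x0 ellp_norm_ge0.
have {}y0 : 0 < ellp_norm y by rewrite lt_neqAle eq_sym y0 ellp_norm_ge0.
apply: ellp_norm_le; first by rewrite addr_ge0 ?ellp_norm_ge0.
apply: le_trans (pow_sumD_le x y x0 y0) _.
rewrite !pow_sumE.
move: (ellp_norm x) (ellp_norm y) x0 y0 => r s r0 s0.
rewrite -[(_ + _)%E]/((r / (r + s) * r^-1 `^ p * r `^ p +
                       s / (r + s) * s^-1 `^ p * s `^ p)%:E).
rewrite -EFinM lee_fin -![_ * _ `^ p * _]mulrA -!powRM ?invr_ge0 ?(ltW r0) ?(ltW s0)//.
rewrite !mulVf ?lt0r_neq0// powR1 !mulr1 -mulrDl divff ?mulr1//.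
by rewrite lt0r_neq0// addr_gt0.
Qed.

HB.instance Definition _ :=
  Lmodule_isNormed.Build R (ellp p1) ellp_normD ellp_normZ ellp_norm0_eq0.

Lemma ellp_normrE (x : ellp p1) : `|x| = fine (pow_sum x) `^ p^-1.
Proof. by []. Qed.
End ellp.

Section baker.
Context (R : realType).
Local Notation RN := {ptws nat -> R}.
Local Notation lambda := (@lebesgue_measure R).
Implicit Types (A : nat -> set R) (E X : set RN).

(* A rectangle is given by the sequence of its factors. *)
Definition rect A : set RN := [set x | forall n, A n (x n)].

Definition partial_vol A (n : nat) : R := \prod_(i < n) fine (lambda (A i)).

Definition vol A : R := limn (partial_vol A).

(* The product of the measures converges in [0, +oo[: the partial products are
   nonnegative reals, so it suffices that they converge in [R]. The limit 0 is
   allowed. *)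
Definition vol_finite A : Prop :=
  [/\ forall n, measurable (A n),
      forall n, (lambda (A n) < +oo)%E &
      cvgn (partial_vol A)].

Definition baker_cover E : set (nat -> nat -> set R) :=
  [set A | (forall k, vol_finite (A k)) /\ E `<=` \bigcup_k rect (A k)].

Definition baker_outer E : \bar R :=
  ereal_inf [set (\sum_(k <oo) (vol (A k))%:E)%E | A in baker_cover E].

Lemma partial_vol_ge0 A n : 0 <= partial_vol A n.
Proof. by apply: prodr_ge0 => i _; exact: fine_ge0. Qed.

Lemma vol_ge0 A : vol_finite A -> 0 <= vol A.
Proof.
by case=> _ _ cA; apply: limr_ge => //; apply: nearW; exact: partial_vol_ge0.
Qed.

Lemma baker_outer_ge0 E : (0 <= baker_outer E)%E.
Proof.
apply: le_ereal_inf_tmp => _ [A [vA _] <-].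
by apply: nneseries_ge0 => k _ _; rewrite lee_fin vol_ge0.
Qed.

Lemma le_baker_outer : {homo baker_outer : E X / E `<=` X >-> (E <= X)%E}.
Proof.
move=> E X EX; apply: ereal_inf_le_tmp => _ [A [vA XA] <-].
by exists A => //; split => //; exact: subset_trans XA.
Qed.

Lemma partial_vol0 n : partial_vol (fun=> set0) n.+1 = 0.
Proof. by rewrite /partial_vol big_ord_recl measure0 mul0r. Qed.

Lemma cvg_partial_vol0 : partial_vol (fun=> set0) @ \oo --> (0 : R).
Proof.
rewrite -(cvg_shiftS (partial_vol (fun=> set0))).
by under eq_fun do rewrite partial_vol0; exact: cvg_cst.
Qed.

Lemma vol_finite0 : vol_finite (fun=> set0).
Proof.
split=> // n; first by rewrite measure0.
by apply: cvgP; exact: cvg_partial_vol0.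
Qed.

Lemma vol0 : vol (fun=> set0) = 0.
Proof. exact/cvg_lim/cvg_partial_vol0. Qed.

Lemma baker_outer0 : baker_outer set0 = 0%E.
Proof.
apply/eqP; rewrite eq_le baker_outer_ge0 andbT.
apply: ereal_inf_lbound; exists (fun=> fun=> set0).
  by split => // k; exact: vol_finite0.
by apply: eseries0 => k _ _; rewrite vol0.
Qed.

Lemma baker_outer_sigma_subadditive : sigma_subadditive baker_outer.
Proof.
move=> E; have [[i ioo]|] := pselect (exists i, baker_outer (E i) = +oo%E).
  rewrite (eseries_pinfty _ _ ioo) ?leey// => n _.
  by rewrite -ltNye (lt_le_trans _ (baker_outer_ge0 _)).
rewrite -forallNE => Eoo.
suff add2e (e : {posnum R}) :
    (baker_outer (\bigcup_n E n) <= \sum_(i <oo) baker_outer (E i) + e%:num%:E)%E.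
  by apply/lee_addgt0Pr => _/posnumP[].
rewrite (le_trans _ (epsilon_trick _ _ _))//; last first.
  by move=> n; exact: baker_outer_ge0.
pose P n (B : nat -> nat -> set R) := baker_cover (E n) B /\
  (\sum_(k <oo) (vol (B k))%:E <= baker_outer (E n) + (e%:num / (2 ^ n.+1)%:R)%:E)%E.
have [G PG] : {G : nat -> nat -> nat -> set R & forall n, P n (G n)}.
  apply: (@choice _ _ P) => n; rewrite /P.
  have Efin : baker_outer (E n) \is a fin_num.
    by rewrite ge0_fin_numE ?baker_outer_ge0// ltey; apply/eqP; exact: Eoo.
  have en1 : 0 < e%:num / (2 ^ n.+1)%:R by [].
  have [_ [B cB <-] BE] := lb_ereal_inf_adherent en1 Efin.
  by exists B; split => //; exact/ltW.
pose v (nk : nat * nat) : \bar R := (vol (G nk.1 nk.2))%:E.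
have v0 nk : (0 <= v nk)%E by rewrite lee_fin vol_ge0//; exact: (PG nk.1).1.1.
apply: (@le_trans _ _ (\esum_(i in setT) v i)%E).
  apply: ereal_inf_lbound => /=.
  have /card_esym/ppcard_eqP[f] := card_nat2.
  exists (fun k => G (f k).1 (f k).2).
    split => [k|]; first exact: (PG (f k).1).1.1.
    move=> t [i _ /(PG i).1.2 [j _ Gt]].
    by exists (f^-1%FUN (i, j)) => //=; rewrite invK ?inE.
  rewrite -(esum_pred_image v _ xpredT) ?[fun=> _]set_true//.
  by rewrite image_eq.
rewrite (_ : esum _ _ = \sum_(i <oo) \sum_(j <oo ) v (i, j))%E; last first.
  pose J : nat -> set (nat * nat) := fun i => [set (i, j) | j in setT].
  rewrite (_ : setT = \bigcup_k J k); last first.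
    by rewrite predeqE => -[a b]; split => // _; exists a => //; exists b.
  rewrite esum_bigcupT /=; last 2 first.
    - apply/trivIsetP => i j _ _ ij.
      rewrite predeqE => -[n m] /=; split => //= -[] [_] _ [<-{n} _].
      by move=> [m' _] [] /esym/eqP; rewrite (negbTE ij).
    - by [].
  rewrite -(image_id [set: nat]) -fun_true esum_pred_image//; last first.
    by move=> n _; exact: esum_ge0.
  apply: eq_eseriesr => /= j _.
  rewrite -(esum_pred_image v (pair j) predT)//=; last first.
    by move=> ? ? _ _; exact: (@can_inj _ _ _ snd).
  by congr esum; rewrite predeqE => -[a b]; split; move=> [i _ <-]; exists i.
apply: lee_nneseries => n *; last exact: (PG n).2.
by apply: nneseries_ge0 => m *.
Qed.

HB.instance Definition _ := isOuterMeasure.Build R RN baker_outer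
  baker_outer0 baker_outer_ge0 le_baker_outer baker_outer_sigma_subadditive.

Definition cut_factor A i (B : set R) : nat -> set R :=
  fun n => if n == i then A n `&` B else A n.

Lemma le_lambdaI (A B : set R) : measurable A -> measurable B ->
  (lambda (A `&` B) <= lambda A)%E.
Proof.
move=> mA mB; have mAB : measurable (A `&` B) by exact: measurableI.
apply: le_measure; rewrite ?inE.
- exact: mAB.
- exact: mA.
- by move=> x [].
Qed.

Lemma partial_vol_cut_factor A i B : vol_finite A -> measurable B ->
  {near \oo, partial_vol (cut_factor A i B) =1
    fun n => fine (lambda (A i `&` B)) / fine (lambda (A i)) * partial_vol A n}.
Proof.
move=> [mA Aoo _] mB; near=> n.
have ni : (i < n)%N by near: n; exact: nbhs_infty_gt.
rewrite /partial_vol (bigD1 (Ordinal ni))//= [in RHS](bigD1 (Ordinal ni))//=.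
rewrite {1}/cut_factor eqxx (eq_bigr (fun j : 'I_n => fine (lambda (A j)))); last first.
  by move=> j; rewrite -val_eqE /cut_factor /= => /negbTE ->.
rewrite mulrA; congr (_ * _).
have [l0|l0] := eqVneq (fine (lambda (A i))) 0; last by rewrite divfK.
rewrite l0 mulr0.
apply/eqP; rewrite eq_le fine_ge0 ?measure_ge0// andbT -l0.
have AB : (lambda (A i `&` B) <= lambda (A i))%E.
  exact: le_lambdaI.
by apply: fine_le => //; rewrite ge0_fin_numE//; apply: le_lt_trans AB _.
Unshelve. all: by end_near. Qed.

Lemma cvg_cut_factor A i (B : set R) : vol_finite A -> measurable B ->
  partial_vol (cut_factor A i B) @ \oo -->
  (fine (lambda (A i `&` B)) / fine (lambda (A i)) * vol A : R).
Proof.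
move=> vA mB; have [_ _ cA] := vA.
apply: (@cvg_trans _ ((fun n => fine (lambda (A i `&` B)) / fine (lambda (A i)) *
    partial_vol A n) @ \oo)).
  by apply: near_eq_cvg; apply: filterS (partial_vol_cut_factor i vA mB) => n ->.
exact: cvgMr.
Qed.

Lemma vol_finite_cut_factor A i (B : set R) : vol_finite A -> measurable B ->
  vol_finite (cut_factor A i B).
Proof.
move=> vA mB; have [mA Aoo _] := vA; split.
- by move=> n; rewrite /cut_factor; case: ifP => // _; exact: measurableI.
- move=> n; rewrite /cut_factor; case: ifP => // _; apply: le_lt_trans (Aoo n).
  exact: le_lambdaI.
- exact: cvgP (cvg_cut_factor vA mB).
Qed.

Lemma cut_factorT A i : cut_factor A i setT = A.
Proof. by apply/funext => n; rewrite /cut_factor setIT; case: ifP. Qed.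

Lemma vol_cut_factorU A i (B : set R) : vol_finite A -> measurable B ->
  vol (cut_factor A i B) + vol (cut_factor A i (~` B)) = vol A.
Proof.
move=> vA mB; have [mA Aoo _] := vA; have mC := measurableC mB.
have volE D : measurable D -> vol (cut_factor A i D) =
    fine (lambda (A i `&` D)) / fine (lambda (A i)) * vol A.
  by move=> mD; apply/cvg_lim => //; exact: cvg_cut_factor.
rewrite -[RHS](congr1 vol (cut_factorT A i)) !volE//.
rewrite -mulrDl -mulrDl setIT; congr (_ / _ * _).
have mAI D : measurable D -> measurable (A i `&` D) by move=> mD; exact: measurableI.
have fin D : measurable D -> lambda (A i `&` D) \is a fin_num.
  move=> mD; rewrite ge0_fin_numE//; apply: le_lt_trans (Aoo i).
  exact: le_lambdaI.
rewrite -fineD ?fin// -measureU//; [|exact: mAI|exact: mAI|].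
  by rewrite -setIUr setUv setIT.
by rewrite setIACA setICr setI0.
Qed.

Lemma cylinder_caratheodory i (B : set R) : measurable B ->
  baker_outer.-caratheodory [set x : RN | B (x i)].
Proof.
move=> mB; apply: le_caratheodory_measurable => X.
apply: le_ereal_inf_tmp => _ [A [vA XA] <-].
have vB k : vol_finite (cut_factor (A k) i B) by exact: vol_finite_cut_factor.
have vC k : vol_finite (cut_factor (A k) i (~` B)).
  by apply: vol_finite_cut_factor => //; exact: measurableC.
rewrite (eq_eseriesr (g := fun k => (vol (cut_factor (A k) i B))%:E +
    (vol (cut_factor (A k) i (~` B)))%:E)%E); last first.
  by move=> k _; rewrite -EFinD vol_cut_factorU.
rewrite nneseriesD; [|by move=> *; rewrite lee_fin vol_ge0..].
apply: leeD; apply: ereal_inf_lbound.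
  exists (fun k => cut_factor (A k) i B) => //; split => // x [/XA[k _ Akx] Bx].
  by exists k => // n; rewrite /cut_factor; case: eqP => [->|]; [split|].
exists (fun k => cut_factor (A k) i (~` B)) => //; split => // x [/XA[k _ Akx] Bx].
by exists k => // n; rewrite /cut_factor; case: eqP => [->|]; [split|].
Qed.

Definition box (s : seq (nat * (rat * rat))) : set RN :=
  [set x | forall t, t \in s -> ratr t.2.1 < x t.1 < ratr t.2.2].

Lemma open_box E x : open E -> E x -> exists2 s, box s x & box s `<=` E.
Proof.
move=> oE Ex.
pose F : set_system RN := filter_from [set s | box s x] box.
have FF : Filter F.
  apply: filter_from_filter; first by exists [::] => t.
  move=> s t sx tx; exists (s ++ t).
    by move=> u; rewrite mem_cat => /orP[/sx|/tx].
  by move=> y st; split=> u us; apply: st; rewrite mem_cat us ?orbT.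
suff : F --> (x : RN).
  by move=> /(_ E (open_nbhs_nbhs (conj oE Ex))) [s sx sE]; exists s.
apply/cvg_sup => i A /=.
move=> [_ [[N oN <-] /= Nx NA]].
have /nbhs_ballP[e /= e0 eN] := open_nbhs_nbhs (conj oN Nx).
have /rat_in_itvoo[q /itvP qP] : x i - e < x i by rewrite ltrBlDr ltrDl.
have /rat_in_itvoo[r /itvP rP] : x i < x i + e by rewrite ltrDl.
exists [:: (i, (q, r))].
  by move=> t; rewrite inE => /eqP ->/=; rewrite qP rP.
move=> y /(_ (i, (q, r))); rewrite mem_head => /(_ isT)/= /andP[qy yr].
apply: NA; apply: eN; rewrite /ball/= distrC ltr_distl.
by rewrite (lt_trans _ qy) ?qP//= (lt_trans yr) ?rP.
Qed.

Lemma box_caratheodory s : baker_outer.-cara.-measurable (box s).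
Proof.
elim: s => [|[i [q r]] s IHs].
  rewrite (_ : box [::] = setT); first exact: measurableT.
  by apply/seteqP; split.
rewrite (_ : box _ = [set x | `]ratr q, ratr r[%classic (x i)] `&` box s).
  by apply: measurableI => //; exact: cylinder_caratheodory.
apply/seteqP; split => [x sx|x [ix sx] t].
  split; first by have := sx (i, (q, r)) (mem_head _ _); rewrite /= in_itv.
  by move=> t ts; apply: sx; rewrite in_cons ts orbT.
rewrite inE => /predU1P[->|/sx//].
by move: ix; rewrite /= in_itv.
Qed.

Definition RN_borel := g_sigma_algebraType (@open RN).

Lemma borel_caratheodory (E : set RN_borel) :
  measurable E -> baker_outer.-cara.-measurable E.
Proof.
apply: smallest_sub; first exact: sigma_algebra_measurable.
move=> O oO; rewrite (_ : O = \bigcup_(s in [set s | box s `<=` O]) box s).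
  rewrite bigcup_mkcond; apply: countable_bigcupT_measurable => [|s].
    exact: countableP.
  by case: ifP => // _; exact: box_caratheodory.
apply/seteqP; split => [x Ox|x [s sO sx]]; last exact: sO.
by have [s sx sO] := open_box oO Ox; exists s.
Qed.

Definition baker_measure (E : set RN_borel) : \bar R := baker_outer E.

Let baker_measure0 : baker_measure set0 = 0%E.
Proof. exact: baker_outer0. Qed.

Let baker_measure_ge0 E : (0 <= baker_measure E)%E.
Proof. exact: baker_outer_ge0. Qed.

Let baker_measure_sigma_additive : semi_sigma_additive baker_measure.
Proof.
move=> F mF tF mUF.
apply: (@caratheodory_measure_sigma_additive _ _ baker_outer) => //.
- by move=> n; exact: borel_caratheodory.
- exact: borel_caratheodory.
Qed.

HB.instance Definition _ := isMeasure.Build _ RN_borel R baker_measure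
  baker_measure0 baker_measure_ge0 baker_measure_sigma_additive.
End baker.

(* Functions on [0, 1] are represented by functions on [R] up to equality almost
   everywhere for Lebesgue measure restricted to [0, 1]. *)
Definition lebesgue01 (R : realType) :
    {measure set (measurableTypeR R) -> \bar R} :=
  mrestr (@lebesgue_measure R) (measurable_itv `[0%R, 1%R]).

Definition isometrically_isomorphic (K : numFieldType) (U V : normedModType K) :
    Prop :=
  exists2 f : {linear U -> V}, bijective f & forall x, `|f x| = `|x|.

(* Main.v *)
Require Import Defs.
From HB Require Import structures.
From mathcomp Require Import finmap.
From mathcomp Require Import all_boot all_order all_algebra.
From mathcomp Require Import all_classical all_reals all_analysis.
From mathcomp Require Import measurable_realfun ring lra.
Set Implicit Arguments.
Unset Strict Implicit.
Unset Printing Implicit Defensive.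
Import Order.TTheory GRing.Theory Num.Theory.
Import numFieldNormedType.Exports.
Local Open Scope classical_set_scope.
Local Open Scope ring_scope.

(** Baker's measure is far from sigma-finite, but a function in L^p lives on
    countably many sets of finite measure, and this is enough to cut
    the space into pieces that look like the unit interval.

    Every set of finite measure is diffuse: fixing the first coordinate cuts each
    covering rectangle down to one with a factor of measure 0
    ([baker_outer_slice]). The Borel sets are generated by the countable
    pi-system of boxes with rational bounds, so the membership bits of a point
    in these boxes can be coded by one real number that generates all Borel sets
    ([measurable_ternary_preimage]). On a set E with 0 < mu(E) < oo, the
    distribution function of that code is continuous; composing with it gives a map
    f from E to [0, 1] that carries mu to mu(E) times Lebesgue measure and
    through which every measurable function on E factors almost everywhere
    ([exists_uniformization]). Hence L^p(E) is L^p[0, 1] up to the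
    factor mu(E)^(1/p).

    Zorn's lemma provides a maximal family of sets E_j of positive finite measure
    with null pairwise intersections ([exists_maximal_family]). A p-integrable
    function is carried by countably many of them: on what
    they leave out, it would otherwise have a superlevel set of positive finite
    measure almost disjoint from all the E_j, against maximality
    ([integrable_countable_cover]). So the p-th power of its norm is the sum of
    the integrals over the E_j ([integral_almost_partition]), and listing
    the restrictions to the E_j, transported to [0, 1], is an isometry onto
    the l^p sum of copies of L^p[0, 1] ([isometrically_isomorphic_glues]).

    It remains to count the E_j. Their number is at most the continuum since
    each is determined, within the family, by the measures of its intersections with
    countably many sets ([card_almost_disjoint]). It is at least the
    continuum since the family can be made to contain continuum many disjoint unit
    cubes; that these have measure 1 and not 0 ([baker_outer_rect]) is where
    the infinite product structure enters, through the argument that shows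
    countable additivity of infinite product measures ([rect_not_covered]). *)

(** * Coding sequences of bits by real numbers *)

Section ternary_coding.
Context {R : realType}.
Implicit Types b : nat -> bool.

Definition ternary_terms b (n : nat) : R := (b n)%:R * 3^-1 ^+ n.

Definition ternary b : R := limn (series (ternary_terms b)).

(** On codes, this Borel map of the line deletes the first bit. *)
Definition ternary_shift (t : R) : R := 3 * (t - \1_(`[1, +oo[%classic) t).

Let third_lt1 : `|3^-1 : R| < 1.
Proof. by rewrite ger0_norm ?invf_lt1 ?invr_ge0 ?ltr1n. Qed.

Lemma ternary_terms_ge0 b n : 0 <= ternary_terms b n.
Proof. by rewrite mulr_ge0 ?exprn_ge0 ?invr_ge0. Qed.

Lemma ternary_terms_le b n : ternary_terms b n <= geometric 1 3^-1 n.
Proof. by rewrite ler_wpM2r ?exprn_ge0 ?invr_ge0 ?lern1 ?leq_b1. Qed.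

Lemma is_cvg_ternary b : cvgn (series (ternary_terms b)).
Proof.
apply: (series_le_cvg (ternary_terms_ge0 b) _ (ternary_terms_le b)).
  by move=> n; rewrite /= mul1r exprn_ge0// invr_ge0.
exact: is_cvg_geometric_series.
Qed.

Lemma ternary_ge0 b : 0 <= ternary b.
Proof.
apply: limr_ge; first exact: is_cvg_ternary.
by apply: nearW => n; apply: sumr_ge0 => i _; exact: ternary_terms_ge0.
Qed.

Lemma ternary_le b : ternary b <= 3 / 2.
Proof.
have -> : 3 / 2 = limn (series (geometric (1 : R) 3^-1)).
  by rewrite (cvg_lim _ (cvg_geometric_series third_lt1))//; field.
apply: lim_series_le; first exact: is_cvg_ternary.
  exact: is_cvg_geometric_series.
exact: ternary_terms_le.
Qed.

Lemma ternaryS b : ternary b = (b 0%N)%:R + 3^-1 * ternary (b \o S).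
Proof.
apply/cvg_lim => //; rewrite -(cvg_shiftS (series _)).
have -> : (fun n => series (ternary_terms b) n.+1) =
    (fun n => (b 0%N)%:R + 3^-1 * series (ternary_terms (b \o S)) n).
  apply/funext => n; rewrite /series /= big_nat_recl// mulr_sumr.
  congr (_ + _); first by rewrite /ternary_terms expr0 mulr1.
  by apply: eq_bigr => i _; rewrite /ternary_terms /= exprS mulrCA.
by apply: cvgD; [exact: cvg_cst|apply: cvgMr; exact: is_cvg_ternary].
Qed.

(** The first bit can be read off the code because all the others
    contribute at most 1/2; in base 2 they could contribute 1. *)
Lemma ternary_digit0 b : b 0%N = (1 <= ternary b).
Proof.
rewrite ternaryS; have := ternary_ge0 (b \o S); have := ternary_le (b \o S).
set t := ternary _ => t1 t0; case: (b 0%N) => /=.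
  by apply/esym; lra.
by apply/esym/negbTE; rewrite -ltNge; lra.
Qed.

Lemma ternary_shiftE b : ternary_shift (ternary b) = ternary (b \o S).
Proof.
rewrite /ternary_shift indicE mem_setE in_itv/= andbT -ternary_digit0.
by rewrite ternaryS; field.
Qed.

Lemma ternary_digit b n : b n = (1 <= iter n ternary_shift (ternary b)).
Proof.
by elim: n b => [|n IH] b; [exact: ternary_digit0|rewrite iterSr ternary_shiftE -IH].
Qed.

Lemma ternary_inj : injective ternary.
Proof. by move=> b c bc; apply/funext => n; rewrite !ternary_digit bc. Qed.

Lemma measurable_ternary_shift : measurable_fun [set: R] ternary_shift.
Proof.
apply: measurable_funM => //; exact: measurable_funB.
Qed.

Lemma measurable_ternary_digit n :
  measurable [set t : R | 1 <= iter n ternary_shift t].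
Proof.
have mi : measurable_fun [set: R] (iter n ternary_shift).
  elim: n => [|n IH] //=; first exact: measurable_id.
  exact: measurableT_comp measurable_ternary_shift IH.
rewrite (_ : [set _ | _] = [set: R] `&` iter n ternary_shift @^-1` `[1, +oo[%classic).
  by apply: mi => //; exact: measurable_itv.
by rewrite setTI; apply/seteqP; split => t /=; rewrite in_itv/= andbT.
Qed.

Lemma measurable_fun_ternary d (T : measurableType d) (B : nat -> set T) :
  (forall n, measurable (B n)) ->
  measurable_fun [set: T] (fun x => ternary (fun n => x \in B n)).
Proof.
move=> mB.
apply: (@measurable_fun_cvg _ _ _ _
  (fun n x => series (ternary_terms (fun n => x \in B n)) n)).
  move=> m; apply: measurable_sum => i; apply: measurable_funM => //.
  have -> : (fun x => (x \in B i)%:R : R) = \1_(B i).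
    by apply/funext => x; rewrite indicE.
  exact: measurable_indic.
by move=> x _; exact: is_cvg_ternary.
Qed.

(** The n-th set is the preimage of the Borel set of the reals whose n-th bit
    is 1, so the single function coding the memberships already generates the
    whole sigma-algebra. *)
Lemma measurable_ternary_preimage d (T : measurableType d) (B : nat -> set T) :
  measurable = <<s range B >> -> forall A : set T, measurable A ->
  exists2 S : set R, measurable S &
    A = (fun x => ternary (fun n => x \in B n)) @^-1` S.
Proof.
move=> mT A; rewrite mT.
move: A; change (<<s range B>> `<=` [set A | exists2 S : set R, measurable S &
  A = (fun x => ternary (fun n => x \in B n)) @^-1` S]).
apply: smallest_sub => [|_ [n _ <-]].
  split.
  - by exists set0; rewrite ?preimage_set0.
  - move=> X [S mS ->]; exists (~` S); first exact: measurableC.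
    by rewrite setTD preimage_setC.
  - move=> F FS; have {FS}[S FS] : {S & forall n, measurable (S n : set R) /\
        F n = (fun x => ternary (fun n => x \in B n)) @^-1` S n}.
      apply: (@choice _ _ (fun n S => measurable (S : set R) /\ F n = _ @^-1` S)) => n.
      by have [S mS ->] := FS n; exists S.
    exists (\bigcup_n S n); first by apply: bigcupT_measurable => n; have [] := FS n.
    by rewrite preimage_bigcup; apply: eq_bigcupr => n _; exact: (FS n).2.
exists [set t : R | 1 <= iter n ternary_shift t].
  exact: measurable_ternary_digit.
by apply/seteqP; split => x; rewrite /preimage /= -ternary_digit inE.
Qed.

End ternary_coding.

(** * The distribution function of a diffuse law *)

Section probability_integral_transform.
Context d (T : measurableType d) (R : realType) (P : probability T R).
Variable X : {RV P >-> R}.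
Hypothesis atomless : forall t, P (X @^-1` [set t]) = 0%E.

Let F t := fine (cdf X t).

Let mX (S : set R) : measurable S -> measurable (X @^-1` S).
Proof. by move=> mS; rewrite -[X in measurable X]setTI; exact: measurable_funPT. Qed.

Let finX (Y : {RV P >-> R}) t : cdf Y t \is a fin_num.
Proof. by rewrite ge0_fin_numE// (le_lt_trans (cdf_le1 _ _)) ?ltry. Qed.

Let F_nd (s t : R) : s <= t -> F s <= F t.
Proof. by move=> st; apply: fine_le => //; exact: cdf_nondecreasing. Qed.

Let PX_le t : P (X @^-1` `]-oo, t]) = (F t)%:E.
Proof. by rewrite /F fineK. Qed.

Let XN : {RV P >-> R} := (- (X : {mfun T >-> R}))%R.

(* Without atoms, the distribution functions of X and - X are complementary;
   right continuity of the latter is left continuity of the former. *)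
Let F_cdfN t : F t = 1 - fine (cdf XN (- t)).
Proof.
have XNE : cdf XN (- t) = P (X @^-1` `[t, +oo[).
  by congr (P _); apply/seteqP; split => x /=; rewrite !in_itv/= andbT lerN2.
apply: (addIr (fine (cdf XN (- t)))); rewrite subrK.
apply: EFin_inj; rewrite EFinD !fineK// XNE.
have -> : P (X @^-1` `[t, +oo[) = P (X @^-1` `]t, +oo[).
  rewrite -(@setU1itv _ _ _ _ false)// preimage_setU measureU//; [|exact: mX|].
    by rewrite [X in (X + _)%E](atomless t) add0e.
  rewrite -preimage_setI (_ : _ `&` _ = set0) ?preimage_set0//.
  by apply/seteqP; split => // y [/= ->]; rewrite in_itv/= ltxx.
rewrite -(probability_setT P) /cdf /distribution /pushforward -measureU//.
- by rewrite -preimage_setU -[in RHS](preimage_setT X) -setCitvr setvU.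
- exact: mX.
- exact: mX.
- rewrite -preimage_setI (_ : _ `&` _ = set0) ?preimage_set0//.
  by rewrite -setCitvr setICl.
Qed.

Let F_continuous : continuous F.
Proof.
have rc (Y : {RV P >-> R}) t : fine (cdf Y s) @[s --> t^'+] --> fine (cdf Y t).
  by apply: fine_cvg; rewrite fineK//; exact: cdf_right_continuous.
move=> t; apply/left_right_continuousP; split; last exact: rc.
apply/cvg_at_leftNP; rewrite F_cdfN.
rewrite (_ : F \o -%R = fun s => 1 - fine (cdf XN s)).
  by apply: cvgB; [exact: cvg_cst|exact: rc].
by apply/funext => s; rewrite /= F_cdfN opprK.
Qed.

Let F_attains u : 0 < u < 1 -> exists t, F t = u.
Proof.
move=> /andP[u0 u1].
have /(cvgr_lt 0) /(_ u u0) [a [_ aP]] : F @ -oo --> (0 : R).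
  exact/fine_cvg/cvg_cdfNy0.
have /(cvgr_gt 1) /(_ u u1) [b [_ bP]] : F @ +oo --> (1 : R).
  exact/fine_cvg/cvg_cdfy1.
pose s := Num.min (a - 1) 0; pose t := Num.max (b + 1) 0.
have Fs : F s < u by apply: aP; rewrite gt_min ltrBlDr ltrDl ltr01.
have Ft : u < F t by apply: bP; rewrite lt_max ltrDl ltr01.
have st : s <= t by rewrite ge_min !le_max lexx !orbT.
have [||c _ Fc] := @IVT R F s t u st.
- exact: continuous_subspaceT.
- by rewrite ge_min (ltW Fs) le_max (ltW Ft) orbT.
by exists c.
Qed.

Let mF : measurable_fun [set: R] F.
Proof. exact: nondecreasing_measurable. Qed.

Let mFX (S : set R) : measurable S -> measurable ((F \o X) @^-1` S).
Proof.
move=> mS; rewrite comp_preimage; apply: mX.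
by rewrite -[X in measurable X]setTI; exact: mF.
Qed.

(** The event [F X <= u] contains the event [X <= t] for some [t] with [F t = u], and
    is contained in such an event for some [t] with [F t = u + e], [e] being
    arbitrarily small. *)
Lemma probability_cdf_le u : 0 <= u <= 1 ->
  P ((F \o X) @^-1` `]-oo, u]) = u%:E.
Proof.
move=> /andP[u0 u1].
have F1 x : F (X x) <= 1 by rewrite -lee_fin fineK// cdf_le1.
apply/eqP; rewrite eq_le; apply/andP; split; last first.
  have [->//|u_neq0] := eqVneq u 0.
  have [->|u_neq1] := eqVneq u 1.
    rewrite -(probability_setT P); apply: le_measure; rewrite ?inE//.
      exact: mFX.
    by move=> x _ /=; rewrite in_itv/=.
  have [|t Ft] := @F_attains u; first by rewrite lt0r u_neq0 u0 lt_neqAle u_neq1.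
  rewrite -Ft -PX_le; apply: le_measure; rewrite ?inE; [exact: mX|exact: mFX|].
  by move=> x /=; rewrite !in_itv/= => /F_nd.
apply/lee_addgt0Pr => e e0; rewrite -EFinD.
have [ue1|ue1] := ltP (u + e) 1; last first.
  by apply: le_trans (probability_le1 _ _) _ => //; exact: mFX.
have [|t Ft] := @F_attains (u + e); first by rewrite ue1 ltr_wpDl.
rewrite -Ft -PX_le; apply: le_measure; rewrite ?inE; [exact: mFX|exact: mX|].
move=> x /=; rewrite !in_itv/= => Fu; rewrite leNgt; apply/negP => /ltW/F_nd.
by rewrite Ft leNgt => /negP; apply; rewrite (le_lt_trans Fu)// ltrDl.
Qed.

Lemma probability_integral_transform (S : set R) : measurable S ->
  P ((F \o X) @^-1` S) = lebesgue01 R S.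
Proof.
move=> mS.
pose FX : T -> measurableTypeR R := F \o X.
have mFX' : measurable_fun [set: T] FX.
  by move=> _ A mA; rewrite setTI; exact: mFX.
pose m1 : {measure set (measurableTypeR R) -> \bar R} :=
  measure_function_pushforward__canonical__measure_function_Measure P mFX'.
suff: m1 S = lebesgue01 R S by [].
refine (@measure_unique _ R (measurableTypeR R) (@RGenOInfty.G R)
  (fun n => `](- n%:R), +oo[%classic) (RGenOInfty.measurableE R) _ _ _
  m1 (lebesgue01 R) _ _ S mS).
- move=> _ _ [x ->] [y ->]; exists (Num.max x y).
  by apply/seteqP; split=> z /=; rewrite !in_itv/= !andbT gt_max => /andP.
- by move=> n; exists (- n%:R).
- rewrite -subTset => x _; exists (Num.truncn `|x|).+1 => //=.
  by rewrite in_itv/= andbT ltrNl (le_lt_trans (ler_norm _))// normrN truncnS_gt.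
- move=> _ [u ->].
  have -> : m1 `]u, +oo[%classic = (1 - P ((F \o X) @^-1` `]-oo, u]))%E.
    rewrite -probability_setC; last exact: mFX.
    by rewrite -setCitvl.
  rewrite -[RHS]/(lebesgue_measure (`]u, +oo[%classic `&` `[0, 1]%classic)).
  have [u0|u0] := ltP u 0.
    rewrite (_ : _ @^-1` _ = set0); last first.
      apply/seteqP; split=> // x /=; rewrite in_itv/= leNgt => /negP; apply.
      by rewrite (lt_le_trans u0)// fine_ge0 ?cdf_ge0.
    rewrite measure0 sube0 setIidr; last first.
      by move=> x /=; rewrite !in_itv/= andbT => /andP[/(lt_le_trans u0)].
    by rewrite lebesgue_measure_itv/= lte_fin ltr01 sube0.
  have [u1|u1] := leP u 1.
    rewrite probability_cdf_le ?u0//.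
    rewrite (_ : _ `&` _ = `]u, 1]%classic); last first.
      apply/seteqP; split=> x /=; rewrite !in_itv/= andbT.
        by move=> [-> /andP[_ ->]].
      by move=> /andP[ux ->]; rewrite ux (le_trans u0 (ltW ux)).
    rewrite lebesgue_measure_itv/= lte_fin; case: ltP => // u1'.
    by rewrite (_ : u = 1) ?subee//; apply/eqP; rewrite eq_le u1.
  rewrite (_ : _ @^-1` _ = setT); last first.
    rewrite -subTset => x _ /=; rewrite in_itv/= (le_trans _ (ltW u1))//.
    by rewrite -lee_fin fineK// cdf_le1.
  rewrite probability_setT subee// (_ : _ `&` _ = set0) ?measure0//.
  apply/seteqP; split=> // x /=; rewrite !in_itv/= andbT.
  by move=> [/(lt_trans u1)]; rewrite ltNge => /negbTE ->; rewrite andbF.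
- move=> n; rewrite /m1/=; apply: le_lt_trans (ltry 1).
  by apply: probability_le1; exact: mFX.
Qed.
End probability_integral_transform.

(** * Uniformizing a diffuse set of finite measure *)

Section uniformization.
Context d (T : measurableType d) (R : realType).
Variables (mu : {measure set T -> \bar R}) (B : nat -> set T).
Hypothesis B_gen : measurable = <<s range B>>.
(* The set below is the atom of the sigma-algebra that contains [x]. *)
Hypothesis cell0 : forall E x, measurable E -> (mu E < +oo)%E ->
  mu (E `&` [set y | forall n, (y \in B n) = (x \in B n)]) = 0%E.

Let mB n : measurable (B n).
Proof. by rewrite B_gen; apply: sub_sigma_algebra; exists n. Qed.

Let code (x : T) : R := ternary (fun n => x \in B n).

Let mcode : measurable_fun [set: T] code.
Proof. exact: measurable_fun_ternary. Qed.

Definition uniform_on (E : set T) (f : T -> R) : Prop :=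
  forall S : set R, measurable S ->
    mu (E `&` f @^-1` S) = (mu E * lebesgue01 R S)%E.

Definition factors_on (E : set T) (f : T -> R) : Prop :=
  forall h : T -> R, measurable_fun [set: T] h ->
    exists2 k : R -> R, measurable_fun [set: R] k &
      {ae mu, forall x, E x -> h x = k (f x)}.

(** If [S q] is the set of parameters matching the sublevel set of [h] at the
    rational [q], then [h] is the infimum of the rationals [q] such that
    [f x] lies in [S q]. *)
Lemma factors_on_sets (E : set T) (f : T -> R) :
  (forall A : set T, measurable A -> exists2 S : set R, measurable S &
    {ae mu, forall x, E x -> (A x <-> S (f x))}) ->
  factors_on E f.
Proof.
move=> fE h mh.
pose lev (q : rat) := [set x | h x < ratr q].
have mlev q : measurable (lev q).
  rewrite (_ : lev q = [set: T] `&` h @^-1` `]-oo, ratr q[%classic).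
    by apply: mh => //; exact: measurable_itv.
  by rewrite setTI; apply/seteqP; split => x; rewrite /lev /= in_itv.
have [S SP] : {S : rat -> set R & forall q, measurable (S q) /\
    {ae mu, forall x, E x -> (lev q x <-> S q (f x))}}.
  apply: (@choice _ _ (fun q S => measurable S /\
    {ae mu, forall x, E x -> (lev q x <-> S (f x))})) => q.
  by have [S mS SE] := fE _ (mlev q); exists S.
(* Indices that encode no rational contribute +oo to the infimum. *)
pose u n t : \bar R := if unpickle n is Some q then
  (if t \in S q then (ratr q)%:E else +oo)%E else +oo%E.
have mu_ n : measurable_fun [set: R] (u n).
  rewrite /u; case: (unpickle n) => [q|]; last exact: measurable_cst.
  apply: measurable_fun_ifT => //; apply: (measurable_fun_bool true).
  rewrite setTI (_ : _ @^-1` _ = S q); first exact: (SP q).1.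
  by apply/seteqP; split=> t; [exact: set_mem|exact: mem_set].
exists (fun t => fine (einfs (u^~ t) 0%N)).
  apply: measurableT_comp => //; exact: measurable_fun_einfs.
have aeS : {ae mu, forall x, forall n, if unpickle n is Some q then
    E x -> (lev q x <-> S q (f x)) else True}.
  apply: ae_foralln => n; case: (unpickle n) => [q|]; last exact: aeW.
  exact: (SP q).2.
apply: filterS aeS => x xS Ex.
suff -> : einfs (u^~ (f x)) 0%N = (h x)%:E by [].
have xS' q : lev q x <-> S q (f x).
  by have := xS (pickle q); rewrite pickleK; exact.
apply/eqP; rewrite eq_le; apply/andP; split.
  apply/lee_addgt0Pr => e e0.
  have /rat_in_itvoo[q /itvP qP] : h x < h x + e by rewrite ltrDl.
  apply: (@le_trans _ _ (ratr q)%:E); last by rewrite -EFinD lee_fin qP.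
  apply: ereal_inf_lbound; exists (pickle q) => //.
  by rewrite /u pickleK mem_set//; apply/xS'; rewrite /lev /= qP.
apply: le_ereal_inf_tmp => _ [n _ <-]; rewrite /u.
case: (unpickle n) => [q|]; last by rewrite leey.
case: ifPn => [|_]; last by rewrite leey.
by rewrite inE => /xS'; rewrite lee_fin => /ltW.
Qed.

(** Code the points of [E] by reals and compose with the distribution function
    [F] of the code. Null cells make the law of the code diffuse, hence the
    composite uniform. Nothing measurable is lost although [F] may be constant on
    intervals: these are null, so the event that the code exceeds [t] is
    almost the event that its image by [F] exceeds [F t], and such events generate
    the sigma-algebra. *)
Lemma exists_uniformization (E : set T) :
  measurable E -> (0 < mu E)%E -> (mu E < +oo)%E ->
  exists f : T -> R, [/\ measurable_fun [set: T] f, uniform_on E f & factors_on E f].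
Proof.
move=> mE E0 Eoo.
have Efin : mu E \is a fin_num by rewrite ge0_fin_numE.
have m0 : 0 < fine (mu E) by rewrite fine_gt0// E0 Eoo.
have mV0 : 0 <= (fine (mu E))^-1 by rewrite invr_ge0 ltW.
pose P0 := mscale (NngNum mV0) (mrestr mu mE).
have P0E A : P0 A = ((fine (mu E))^-1%:E * mu (A `&` E))%E by [].
have P01 : P0 setT = 1%E.
  by rewrite P0E setTI -(fineK Efin) -EFinM mulVf// gt_eqF.
pose P : probability T R := HB.pack P0 (Measure_isProbability.Build _ _ _ P0 P01).
have muE A : (mu (E `&` A) = mu E * P A)%E.
  rewrite -[P A]/(P0 A) P0E setIC muleA -[X in (X * _ * _)%E](fineK Efin).
  by rewrite -EFinM mulfV ?gt_eqF// mul1e.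
pose X : {mfun T >-> R} := HB.pack code (isMeasurableFun.Build _ _ _ _ code mcode).
have X_diffuse t : P (X @^-1` [set t]) = 0%E.
  have mXt : measurable (X @^-1` [set t]).
    by rewrite -[_ @^-1` _]setTI; exact: mcode.
  rewrite -[LHS]/(P0 _) P0E [mu (_ `&` _)](_ : _ = 0%E) ?mule0//.
  have [[x xt]|nt] := pselect (exists x, code x = t); last first.
    rewrite (_ : _ @^-1` _ = set0) ?set0I ?measure0//.
    by apply/seteqP; split => // x /= xt; apply: nt; exists x.
  apply/eqP; rewrite eq_le measure_ge0 andbT -(@cell0 E x mE Eoo).
  apply: le_measure; rewrite ?inE.
  - exact: measurableI.
  - apply: measurableI => //.
    rewrite (_ : [set y | _] = \bigcap_n (if x \in B n then B n else ~` B n)).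
      apply: bigcapT_measurable => n; case: ifP => // _; exact: measurableC.
    apply/seteqP; split => y.
      move=> yx n _; have := yx n; case: ifP => [_ /set_mem//|_ /negbT].
      by rewrite notin_setE.
    move=> yB n; have := yB n I; case: ifP => [_ /mem_set//|_ yn].
    by apply/negbTE; rewrite notin_setE.
  - move=> y [yt Ey]; split => // n.
    by have /ternary_inj/(congr1 (fun b => b n)) : code y = code x by rewrite xt.
pose F t := fine (cdf (X : {RV P >-> R}) t).
have PFX := @probability_integral_transform _ _ _ P X X_diffuse.
have F_nd s t : s <= t -> F s <= F t.
  by move=> st; apply: fine_le; rewrite ?fin_num_measure//; exact: cdf_nondecreasing.
have mF : measurable_fun [set: R] F by exact: nondecreasing_measurable.
have mf : measurable_fun [set: T] (F \o code) by exact: measurableT_comp.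
exists (F \o code); split => //.
  by move=> S mS; rewrite muE PFX.
apply: factors_on_sets => A mA.
have [S' mS' ->] := @measurable_ternary_preimage R _ _ _ B_gen _ mA.
pose G := [set S' : set R | exists2 S : set R, measurable S &
   {ae mu, forall x, E x -> (S' (code x) <-> S (F (code x)))}].
suff: measurable `<=` G by move=> /(_ _ mS').
rewrite -[measurable]/((@ocitv R).-sigma.-measurable) RGenOInfty.measurableE.
apply: smallest_sub => [|_ [t ->]].
  split.
  - by exists set0 => //; exact: aeW.
  - move=> S1 [S mS S1S]; exists (~` S); first exact: measurableC.
    by apply: filterS S1S => x xS /xS{}xS; rewrite setTD /setC/= xS.
  - move=> H HG; have {HG}[S SP] : {S : nat -> set R & forall n, measurable (S n) /\
        {ae mu, forall x, E x -> (H n (code x) <-> S n (F (code x)))}}.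
      apply: (@choice _ _ (fun n S => measurable S /\
        {ae mu, forall x, E x -> (H n (code x) <-> S (F (code x)))})) => n.
      by have [S mS SE] := HG n; exists S.
    exists (\bigcup_n S n); first by apply: bigcupT_measurable => n; have [] := SP n.
    have : {ae mu, forall x, forall n, E x -> (H n (code x) <-> S n (F (code x)))}.
      by apply: ae_foralln => n; exact: (SP n).2.
    apply: filterS => x xS Ex; split => -[n _ Hn]; exists n => //; exact/xS.
exists `]F t, +oo[%classic; first exact: measurable_itv.
have mFt : measurable ((F \o code) @^-1` `]-oo, F t]).
  by rewrite -[_ @^-1` _]setTI; apply: mf => //; exact: measurable_itv.
have mXt : measurable (code @^-1` `]-oo, t]).
  by rewrite -[_ @^-1` _]setTI; apply: mcode => //; exact: measurable_itv.
have mN : measurable (E `&` ((F \o code) @^-1` `]-oo, F t] `\` code @^-1` `]-oo, t])).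
  by apply: measurableI => //; exact: measurableD.
exists (E `&` ((F \o code) @^-1` `]-oo, F t] `\` code @^-1` `]-oo, t])); split => //.
  rewrite muE measureD//; last by rewrite (le_lt_trans (probability_le1 _ _)) ?ltry.
  rewrite setIidr; last by move=> x; rewrite /= !in_itv/= => /F_nd.
  rewrite [X in (X - _)%E](_ : _ = (F t)%:E); last first.
    apply: (probability_cdf_le X_diffuse); rewrite fine_ge0 ?cdf_ge0//=.
    by rewrite -lee_fin fineK ?fin_num_measure//; exact: cdf_le1.
  rewrite [X in (_ - X)%E](_ : _ = (F t)%:E); last first.
    by rewrite /F fineK// fin_num_measure.
  by rewrite subee ?mule0.
move=> x /=; apply: contra_notP => nx Ex; rewrite !in_itv/= !andbT.
split; last by rewrite !ltNge; apply: contra => /F_nd.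
move=> tx; rewrite ltNge; apply/negP => Fx; apply: nx; split => //.
by rewrite !in_itv/=; split => //; apply/negP; rewrite -ltNge.
Qed.
End uniformization.

(** * Maximal families of almost disjoint sets *)

Section maximal_family.
Context d (T : measurableType d) (R : realType).
Variables (mu : {measure set T -> \bar R}) (B : nat -> set T).
Hypothesis B_gen : measurable = <<s range B>>.
Hypothesis BI : setI_closed (range B).
Hypothesis BT : range B setT.

Definition finite_positive (A : set T) : Prop :=
  [/\ measurable A, (0 < mu A)%E & (mu A < +oo)%E].

Definition almost_disjoint (F : set (set T)) : Prop :=
  forall A A', F A -> F A' -> A <> A' -> mu (A `&` A') = 0%E.

Let mB n : measurable (B n).
Proof. by rewrite B_gen; apply: sub_sigma_algebra; exists n. Qed.

(** A set [A] of finite measure is determined up to null sets by the restriction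
    of the measure to [A], hence by its values on the countable pi-system,
    hence by the cuts that these reals make in the rationals: a sequence of bits. *)
Lemma card_almost_disjoint (F : set (set T)) :
  F `<=` finite_positive -> almost_disjoint F -> (F #<= [set: R])%card.
Proof.
move=> Ffp Fad; apply/pcard_injP.
pose bits (A : set T) n := if unpickle n is Some (m, q) then
  fine (mu (A `&` B m)) < ratr q else false.
exists (fun A => ternary (bits A)) => A A' /set_mem FA /set_mem FA' /ternary_inj AA'.
have [mA A0 Aoo] := Ffp _ FA; have [mA' A'0 A'oo] := Ffp _ FA'.
have fin C D : measurable C -> (mu C < +oo)%E -> measurable D ->
    mu (C `&` D) \is a fin_num.
  move=> mC Coo mD; rewrite ge0_fin_numE//; apply: le_lt_trans Coo.
  by apply: le_measure; rewrite ?inE//; exact: measurableI.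
have muB m : mu (A `&` B m) = mu (A' `&` B m).
  rewrite -(fineK (fin _ _ mA Aoo (mB m))) -(fineK (fin _ _ mA' A'oo (mB m))).
  have bitsE q : (fine (mu (A `&` B m)) < ratr q) = (fine (mu (A' `&` B m)) < ratr q).
    by have := congr1 (fun b => b (pickle (m, q))) AA'; rewrite /bits pickleK.
  congr EFin; apply/eqP; rewrite eq_le; apply/andP; split; rewrite leNgt; apply/negP.
    move=> /rat_in_itvoo[q]; rewrite in_itv/= => /andP[q1 q2].
    by have := bitsE q; rewrite q1 ltNge (ltW q2).
  move=> /rat_in_itvoo[q]; rewrite in_itv/= => /andP[q1 q2].
  by have := bitsE q; rewrite q1 ltNge (ltW q2).
have muA C : measurable C -> mu (A `&` C) = mu (A' `&` C).
  move=> mC; rewrite ![_ `&` C]setIC.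
  refine (@measure_unique _ R T (range B) (fun=> setT) B_gen BI _ _
    (mrestr mu mA) (mrestr mu mA') _ _ C mC).
  - by move=> _; exact: BT.
  - by rewrite -subTset => x _; exists 0%N.
  - by move=> _ [m _ <-]; rewrite /= /mrestr !(setIC (B m)).
  - by move=> _; rewrite /= /mrestr setTI.
apply: contrapT => /(Fad _ _ FA FA').
by rewrite setIC -muA// setIid => /eqP; rewrite gt_eqF.
Qed.

(** The family [Q] is there to make the maximal family as large as the continuum. *)
Lemma exists_maximal_family (Q : R -> set T) (J : choiceType) :
  (forall r, finite_positive (Q r)) ->
  (forall r s, r <> s -> mu (Q r `&` Q s) = 0%E) ->
  ([set: J] #= [set: R])%card ->
  exists E : J -> set T, [/\ forall j, finite_positive (E j),
    forall i j, i <> j -> mu (E i `&` E j) = 0%E &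
    forall A, measurable A -> (mu A < +oo)%E ->
      (forall j, mu (A `&` E j) = 0%E) -> mu A = 0%E].
Proof.
move=> Qfp Qad JR.
(* Zorn's lemma is applied to what is added to [Q], as the union of the empty
   chain could not contain [Q]. *)
pose P F := F `|` range Q `<=` finite_positive /\ almost_disjoint (F `|` range Q).
have [F0 [[Ffp Fad] Fmax]] : exists F, P F /\ forall G, F `<` G -> ~ P G.
  apply: Zorn_bigcup => F FP Ftot; split.
    move=> A [[X FX XA]|[r _ <-]]; last exact: Qfp.
    by apply: (FP _ FX).1; left.
  move=> A A' [[X FX XA]|QA] [[Y FY YA']|QA'].
  - have [XY|YX] := Ftot _ _ FX FY.
      by apply: (FP _ FY).2; left => //; exact: XY.
    by apply: (FP _ FX).2; left => //; exact: YX.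
  - by apply: (FP _ FX).2; [left|right].
  - by apply: (FP _ FY).2; [right|left].
  - move: QA QA' => [r _ <-] [s _ <-] rs; apply: Qad => rsE; apply: rs.
    by rewrite rsE.
pose F := F0 `|` range Q.
have Qinj : injective Q.
  move=> r s rs; apply: contrapT => /Qad; rewrite rs setIid => /eqP.
  by have [_ + _] := Qfp s; rewrite lt0e => /andP[/negbTE ->].
have FR : (F #= [set: R])%card.
  apply: Cantor_Bernstein; first exact: card_almost_disjoint.
  apply/card_subP; exists (range Q); last by move=> A QA; right.
  by apply: inj_card_eq => r s _ _; exact: Qinj.
have /card_set_bijP[E [EF Einj Esurj]] : ([set: J] #= F)%card.
  by apply: card_eq_trans JR _; rewrite card_eq_sym.
exists E; split.
- by move=> j; apply: Ffp; exact: EF.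
- move=> i j ij; apply: Fad; [exact: EF|exact: EF|move=> Eij; apply: ij].
  by apply: Einj Eij; rewrite inE.
- move=> A mA Aoo AE; apply: contrapT => /eqP A0.
  have AF C : F C -> mu (A `&` C) = 0%E by move=> /Esurj[j _ <-].
  have AnF : ~ F0 A.
    by move=> FA; have := AF A (or_introl FA); rewrite setIid; apply/eqP.
  apply: (Fmax (F0 `|` [set A])).
    split; first exact: subsetUl.
    by move=> /(_ A (or_intror erefl)).
  have FUE : (F0 `|` [set A]) `|` range Q `<=` F `|` [set A].
    by move=> C [[FC|->]|QC]; [left; left|right|left; right].
  split.
    move=> C /FUE[/Ffp//|->]; split => //; by rewrite lt0e A0 measure_ge0.
  move=> C D /FUE[FC|->] /FUE[FD|->]; [exact: Fad| | |].
  - by move=> _; rewrite setIC AF.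
  - by move=> _; rewrite AF.
  - by move=> /(_ erefl).
Qed.
End maximal_family.

(** * Integrals over almost disjoint families *)

Lemma countable_bigcup_measurable d (T : measurableType d) (I : Type)
    (C : set I) (F : I -> set T) :
  countable C -> (forall i, C i -> measurable (F i)) ->
  measurable (\bigcup_(i in C) F i).
Proof.
move=> /countable_injP[c c_inj] mF.
rewrite (_ : \bigcup_(i in C) F i =
    \bigcup_n \bigcup_(i in [set i | C i /\ c i = n]) F i).
  apply: bigcupT_measurable => n.
  have [[i Ci cin]|nC] := pselect (exists2 i, C i & c i = n).
    rewrite (_ : [set _ | _] = [set i]); first by rewrite bigcup_set1; exact: mF.
    apply/seteqP; split => [j [Cj cjn]|j ->//].
    by apply: c_inj; [exact: mem_set|exact: mem_set|rewrite cjn cin].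
  rewrite (_ : [set _ | _] = set0) ?bigcup_set0//.
  by apply/seteqP; split => // i [Ci cin]; apply: nC; exists i.
apply/seteqP; split => [x [i Ci Fix]|x [n _ [i [Ci _] Fix]]]; last by exists i.
by exists (c i) => //; exists i.
Qed.

Lemma measurable_fun_countable_pieces d (T : measurableType d)
    (R : realType) (I : Type) (C : set I) (D : I -> set T) (g : I -> T -> R)
    (h : T -> R) : countable C ->
  (forall j, measurable (D j)) -> (forall j, measurable_fun [set: T] (g j)) ->
  (forall j x, C j -> D j x -> h x = g j x) ->
  (forall x, ~ (\bigcup_(j in C) D j) x -> h x = 0) ->
  measurable_fun [set: T] h.
Proof.
move=> cC mD mg hg h0 _ S mS; rewrite setTI.
have mU : measurable (\bigcup_(j in C) D j) by exact: countable_bigcup_measurable.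
rewrite (_ : h @^-1` S = (\bigcup_(j in C) (D j `&` g j @^-1` S)) `|`
    (~` (\bigcup_(j in C) D j) `&` (fun=> 0) @^-1` S)); last first.
  apply/seteqP; split=> [x Sx|x [[j Cj [Djx Sx]]|[nx Sx]]].
  - have [[j Cj Djx]|nx] := pselect ((\bigcup_(j in C) D j) x).
      by left; exists j => //; split => //; rewrite /preimage/= -(hg j).
    by right; split => //; rewrite /preimage/= -(h0 x nx).
  - by rewrite /preimage/= (hg j).
  - by rewrite /preimage/= h0.
apply: measurableU.
  apply: countable_bigcup_measurable => // j _; apply: measurableI => //.
  by rewrite -[_ @^-1` _]setTI; exact: mg.
apply: measurableI; first exact: measurableC.
rewrite preimage_cst; case: ifP => _ //; exact: measurableT.
Qed.

Lemma countable_esum_support (R : realType) (J : choiceType) (a : J -> \bar R) :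
  (forall j, 0 <= a j)%E -> (\esum_(j in [set: J]) a j < +oo)%E ->
  countable [set j | a j != 0%E].
Proof.
move=> a0 aoo.
have -> : [set j | a j != 0%E] = \bigcup_n [set j | (n.+1%:R^-1%:E <= a j)%E].
  apply/seteqP; split => j /=; last first.
    by move=> [n _ /=] naj; rewrite gt_eqF// (lt_le_trans _ naj)// lte_fin.
  move=> aj; have {aj} : (0 < a j)%E by rewrite lt0e aj a0.
  case ajE : (a j) => [r| |]// => [|_]; last by exists 0%N => //=; rewrite ajE leey.
  rewrite lte_fin => /ltr_add_invr[n]; rewrite add0r => nr.
  by exists n => //=; rewrite ajE lee_fin ltW.
apply: bigcup_countable => // n _; apply: finite_set_countable.
apply: contrapT => /infinite_set_fset infA.
have [m moo] : exists m, (\esum_(j in [set: J]) a j < (m%:R * n.+1%:R^-1)%:E)%E.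
  have : (0 <= \esum_(j in [set: J]) a j)%E by apply: esum_ge0.
  move: aoo; case: esum => [s| |]// _ s0.
  exists (Num.truncn (s * n.+1%:R)).+1.
  by rewrite lte_fin ltr_pdivlMr// truncnS_gt.
have [X XA Xm] := infA m.
move: moo; apply/negP; rewrite -leNgt.
apply: esum_ge; exists [set` X]; first by split => //; exact: finite_fset.
rewrite fsbig_finite//= set_fsetK.
apply: (@le_trans _ _ (\sum_(j <- finmap.enum_fset X) (n.+1%:R^-1)%:E)%E); last first.
  rewrite big_seq [leRHS]big_seq; apply: lee_sum => j jX.
  exact: (XA j jX).
rewrite sumEFin lee_fin big_const_seq count_predT iter_addr_0 -[leRHS]mulr_natl.
by rewrite ler_wpM2r// ler_nat.
Qed.

Section almost_disjoint_integral.
Context d (T : measurableType d) (R : realType) (J : choiceType).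
Variables (mu : {measure set T -> \bar R}) (E : J -> set T).
Hypothesis mE : forall j, measurable (E j).
Hypothesis E_ad : forall i j, i <> j -> mu (E i `&` E j) = 0%E.

Lemma ae_countable (I : Type) (C : set I) (P : I -> T -> Prop) : countable C ->
  (forall i, C i -> {ae mu, forall x, P i x}) ->
  {ae mu, forall x, forall i, C i -> P i x}.
Proof.
move=> /countable_injP[c c_inj] CP.
have : {ae mu, forall x, forall n, forall i, C i -> c i = n -> P i x}.
  apply: ae_foralln => n.
  have [[i Ci cin]|nC] := pselect (exists2 i, C i & c i = n).
    apply: filterS (CP i Ci) => x Pix j Cj cjn.
    suff -> : j = i by [].
    by apply: c_inj; [exact: mem_set|exact: mem_set|rewrite cjn cin].
  by apply: aeW => x i Ci cin; exfalso; apply: nC; exists i.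
by apply: filterS => x Px i Ci; exact: Px erefl.
Qed.

Lemma ae_notin (A : set T) : measurable A -> mu A = 0%E ->
  {ae mu, forall x, ~ A x}.
Proof. by move=> mA A0; exists A; split => // x /= /contrapT. Qed.

Lemma ae_disjoint (C : set J) j : countable C ->
  {ae mu, forall x, forall i, C i -> E i x -> E j x -> i = j}.
Proof.
move=> cC; apply: ae_countable => // i Ci.
have [->|/eqP ij] := eqVneq i j; first exact: aeW.
have := ae_notin (measurableI _ _ (mE i) (mE j)) (E_ad ij).
by apply: filterS => x /= Eij Eix Ejx; exfalso; exact: Eij.
Qed.

(** Keeping in each member of a countable subfamily only the points that lie in no
    other member makes the family disjoint, and discards only null sets. *)
Definition sole_part (C : set J) (j : J) : set T :=
  [set x | E j x /\ forall i, C i -> E i x -> i = j].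

Lemma sole_partE (C : set J) (j : J) :
  sole_part C j = E j `\` \bigcup_(i in C `\ j) E i.
Proof.
apply/seteqP; split => x.
  move=> [Ejx Cx]; split => // -[i [Ci ij] Eix]; apply: ij; exact: Cx.
move=> [Ejx nx]; split => // i Ci Eix; apply: contrapT => ij.
by apply: nx; exists i.
Qed.

Lemma measurable_sole_part (C : set J) (j : J) : countable C ->
  measurable (sole_part C j).
Proof.
move=> cC; rewrite sole_partE; apply: measurableD => //.
apply: countable_bigcup_measurable => [|i _]; last exact: mE.
by apply: sub_countable cC; apply: subset_card_le => i [].
Qed.

Lemma ae_sole_part (C : set J) j : countable C ->
  {ae mu, forall x, E j x -> sole_part C j x}.
Proof.
move=> cC; apply: filterS (ae_disjoint j cC) => x xE Ejx; split => // i Ci Eix.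
exact: xE.
Qed.

Lemma ge0_eq_integral_ae (A A' : set T) (g : T -> \bar R) :
  measurable A -> measurable A' -> measurable_fun [set: T] g ->
  (forall x, 0 <= g x)%E ->
  {ae mu, forall x, g x <> 0%E -> (A x <-> A' x)} ->
  (\int[mu]_(x in A) g x = \int[mu]_(x in A') g x)%E.
Proof.
move=> mA mA' mg g0 AA'.
rewrite integral_mkcond [RHS]integral_mkcond.
apply: ge0_ae_eq_integral => //.
- by apply/(measurable_restrictT _ mA); exact: measurable_funTS.
- by apply/(measurable_restrictT _ mA'); exact: measurable_funTS.
- by move=> x _; exact: erestrict_ge0.
- by move=> x _; exact: erestrict_ge0.
apply: filterS AA' => x xA _; rewrite !patchE.
have [gx0|/eqP/xA Ax] := eqVneq (g x) 0%E; first by rewrite gx0 !if_same.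
by rewrite (_ : (x \in A) = (x \in A'))//; apply/idP/idP => /set_mem/Ax/mem_set.
Qed.

(** Where [g] does not vanish, [C] covers almost everything; so the members outside
    [C], being almost disjoint from those in [C], contribute 0, and the sum
    reduces to countable additivity over the disjoint parts. *)
Lemma integral_almost_partition (C : set J) (g : T -> \bar R) :
  countable C -> measurable_fun [set: T] g -> (forall x, 0 <= g x)%E ->
  {ae mu, forall x, g x <> 0%E -> exists2 j, C j & E j x} ->
  (\int[mu]_x g x = \esum_(j in [set: J]) \int[mu]_(x in E j) g x)%E.
Proof.
move=> cC mg g0 gC.
have int0 (A : set T) : (0 <= \int[mu]_(x in A) g x)%E by exact: integral_ge0.
have E'E j : (\int[mu]_(x in E j) g x = \int[mu]_(x in sole_part C j) g x)%E.
  apply: ge0_eq_integral_ae => //; first exact: measurable_sole_part.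
  by apply: filterS (ae_sole_part j cC) => x xE _; split => // -[].
have outC j : ~ C j -> (\int[mu]_(x in E j) g x = 0)%E.
  move=> nCj; rewrite -(integral_set0 mu g).
  apply: ge0_eq_integral_ae => //.
  apply: filterS2 gC (ae_disjoint j cC) => x xC xE gx0; split => // Ejx.
  have [i Ci Eix] := xC gx0; apply: nCj.
  by have <- := xE _ Ci Eix Ejx.
have [c c_inj] := countable_injP _ cC.
pose G n := [set x | exists2 j, C j & c j = n /\ sole_part C j x].
have GE j : C j -> G (c j) = sole_part C j.
  move=> Cj; apply/seteqP; split => [x [i Ci [cij]]|x Ejx]; last by exists j.
  have <- // : i = j by apply: c_inj; [exact: mem_set|exact: mem_set|].
have G0 n : ~ (c @` C) n -> G n = set0.
  by move=> nC; apply/seteqP; split => // x [j Cj [cj _]]; apply: nC; exists j.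
have mG n : measurable (G n).
  have [[j Cj <-]|/G0->//] := pselect ((c @` C) n).
  by rewrite GE//; exact: measurable_sole_part.
have tG : trivIset setT G.
  move=> m n _ _ [x [[i Ci [<- [Eix _]]] [j Cj [<- [_ xj]]]]].
  by rewrite (xj i).
transitivity (\int[mu]_(x in \bigcup_n G n) g x)%E.
  apply: ge0_eq_integral_ae => //; first exact: bigcupT_measurable.
  apply: filterS2 gC (ae_countable cC (fun j _ => ae_sole_part j cC)).
  move=> x xC xE gx0; split => // _.
  have [j Cj Ejx] := xC gx0; exists (c j) => //; exists j => //; split => //.
  exact: xE.
rewrite ge0_integral_bigcup//; last exact: measurable_funTS.
rewrite nneseries_esumT// (esumID (c @` C))// [X in (_ + X)%E]esum1 ?adde0; last first.
  by move=> n [_ /G0->]; rewrite integral_set0.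
rewrite setTI (@reindex_esum _ _ _ C (c @` C) c); last exact: inj_bij.
rewrite [RHS](esumID C)// [X in (_ + X)%E]esum1 ?adde0 ?setTI; last first.
  by move=> j /outC.
by apply: eq_esum => j Cj; rewrite GE// E'E.
Qed.

(** Each superlevel set of [g] has finite measure, so it meets only countably many
    of the almost disjoint members in positive measure; the rest of it is almost
    disjoint from all members, hence null by maximality. *)
Lemma integrable_countable_cover (g : T -> \bar R) :
  (forall A, measurable A -> (mu A < +oo)%E ->
    (forall j, mu (A `&` E j) = 0%E) -> mu A = 0%E) ->
  measurable_fun [set: T] g -> (forall x, 0 <= g x)%E ->
  (\int[mu]_x g x < +oo)%E ->
  exists2 C : set J, countable C &
    {ae mu, forall x, g x <> 0%E -> exists2 j, C j & E j x}.
Proof.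
move=> E_max mg g0 goo.
pose S n := [set x | (n.+1%:R^-1%:E <= g x)%E].
have mS n : measurable (S n).
  have := emeasurable_fun_c_infty measurableT mg (n.+1%:R^-1%:E).
  by rewrite setTI.
have Soo n : (mu (S n) < +oo)%E.
  have := @le_integral_abse _ _ _ mu setT measurableT g (n.+1%:R^-1) mg.
  rewrite setTI invr_gt0 ltr0n => /(_ isT).
  under eq_integral do rewrite gee0_abs//.
  rewrite (_ : [set x | _] = S n); last first.
    by apply/seteqP; split => x; rewrite /S /= gee0_abs.
  move=> /le_lt_trans/(_ goo); rewrite muleC -lte_pdivlMr//.
  by move=> /lt_le_trans; apply; rewrite leey.
pose C := \bigcup_n [set j | mu (S n `&` E j) != 0%E].
have cC : countable C.
  apply: bigcup_countable => // n _; apply: countable_esum_support => //.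
  apply: le_lt_trans (Soo n); apply: ge_ereal_sup => _ [X [finX _] <-].
  have mU : measurable (\bigcup_(j in X) E j).
    by apply: fin_bigcup_measurable.
  have mSU : measurable (S n `&` \bigcup_(j in X) E j) by exact: measurableI.
  apply: (@le_trans _ _
    (\int[mu]_x (\1_(S n `&` \bigcup_(j in X) E j) x)%:E)%E); last first.
    rewrite integral_indic// setIT.
    by apply: le_measure; [exact: mem_set|exact: mem_set|exact: subIsetl].
  rewrite (@integral_almost_partition X); last first.
  - apply: aeW => x; rewrite indicE; have [/set_mem|_ /(_ erefl)//] := boolP (x \in _).
    by move=> [_ [j Xj Ejx]] _; exists j.
  - by move=> x; rewrite lee_fin.
  - by apply/measurable_EFinP; exact: measurable_indic.
  - exact: finite_set_countable.
  apply: esum_ge; exists X => //; rewrite !fsbig_finite//=.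
  rewrite big_seq [leRHS]big_seq; apply: lee_sum => j.
  rewrite in_fset_set// => /set_mem Xj.
  rewrite integral_indic//; apply: le_measure;
    [exact/mem_set/measurableI|exact/mem_set/measurableI|].
  by move=> x [Sx Ejx]; split => //; split => //; exists j.
exists C => //.
have mU : measurable (\bigcup_(j in C) E j).
  by apply: countable_bigcup_measurable.
have A0 n : mu (S n `\` \bigcup_(j in C) E j) = 0%E.
  have mA : measurable (S n `\` \bigcup_(j in C) E j) by exact: measurableD.
  apply: E_max => //.
    by apply: le_lt_trans (Soo n); apply: le_measure;
      [exact: mem_set|exact: mem_set|exact: subDsetl].
  move=> j; have [Cj|nCj] := pselect (C j).
    rewrite (_ : _ `&` _ = set0) ?measure0//.
    by apply/seteqP; split => // x [[_ nx] Ejx]; apply: nx; exists j.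
  apply/eqP; apply: contrapT => /negP nz; apply: nCj; exists n => //=.
  apply: contra nz => /eqP SE0; rewrite eq_le measure_ge0 andbT -SE0.
  apply: le_measure; [exact/mem_set/measurableI|exact/mem_set/measurableI|].
  by move=> x [[Sx _] Ejx].
have : {ae mu, forall x, forall n, ~ (S n `\` \bigcup_(j in C) E j) x}.
  apply: ae_foralln => n; apply: ae_notin => //; exact: measurableD.
apply: filterS => x xS /eqP gx0.
have gx : (0 < g x)%E by rewrite lt0e gx0 g0.
have [m Sm] : exists m, S m x.
  move: gx; rewrite /S/=; case: (g x) => [r| |]// => [|_].
  2: by exists 0%N; rewrite leey.
  rewrite lte_fin => /ltr_add_invr[m]; rewrite add0r => mr.
  by exists m; rewrite lee_fin ltW.
by apply: contrapT => nx; apply: (xS m); split.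
Qed.
End almost_disjoint_integral.

(** * The isometry *)

(** A relation is more convenient than a map here: the two spaces consist
    of classes, and their elements are matched by an almost everywhere identity of
    representatives. Linearity and preservation of norms make the relation
    functional and injective. *)
Lemma isometrically_isomorphic_rel (K : numFieldType) (U V : normedModType K)
    (P : U -> V -> Prop) :
  (forall u, exists v, P u v) -> (forall v, exists u, P u v) ->
  (forall a u v u' v', P u v -> P u' v' -> P (a *: u + u') (a *: v + v')) ->
  (forall u v, P u v -> `|v| = `|u|) ->
  isometrically_isomorphic U V.
Proof.
move=> Ptot Psurj Plin Pnorm.
have Pfun u v v' : P u v -> P u v' -> v = v'.
  move=> Puv Puv'; have := Pnorm _ _ (Plin (-1) _ _ _ _ Puv Puv').
  rewrite !scaleN1r addNr normr0 => /normr0_eq0 /eqP.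
  by rewrite addrC subr_eq0 => /eqP.
have Pinj u u' v : P u v -> P u' v -> u = u'.
  move=> Puv Pu'v; have := Pnorm _ _ (Plin (-1) _ _ _ _ Puv Pu'v).
  rewrite !scaleN1r addNr normr0 => /esym/normr0_eq0 /eqP.
  by rewrite addrC subr_eq0 => /eqP.
have [f fP] := choice Ptot; have [g gP] := choice Psurj.
have f_lin : linear f by move=> a u v; exact: Pfun (fP _) (Plin _ _ _ _ _ (fP _) (fP _)).
pose F : {linear U -> V} := HB.pack f (GRing.isLinear.Build _ _ _ _ f f_lin).
exists F; last by move=> u; exact: Pnorm (fP u).
by exists g => [u|v]; [exact: Pinj (gP _) (fP _)|exact: Pfun (fP _) (gP _)].
Qed.

Section Lspace_representatives.
Context d (T : measurableType d) (R : realType).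
Variables (mu : {measure set T -> \bar R}) (p : R) (p1 : (1 <= p%:E)%E).

Let p_neq0 : p != 0.
Proof. by rewrite gt_eqF// (lt_le_trans ltr01). Qed.

Definition abs_pow (h : T -> R) (x : T) : \bar R := (`|h x| `^ p)%:E.

Lemma abs_pow_ge0 h x : (0 <= abs_pow h x)%E.
Proof. by rewrite lee_fin powR_ge0. Qed.

Lemma measurable_abs_pow (h : T -> R) :
  measurable_fun [set: T] h -> measurable_fun [set: T] (abs_pow h).
Proof.
move=> mh; apply/measurable_EFinP.
apply: (@measurableT_comp _ _ _ _ _ _ (fun t => t `^ p)) => //.
exact: (measurableT_comp (@normr_measurable R setT)).
Qed.

Lemma integral_abs_pow (h : T -> R) :
  (\int[mu]_x abs_pow h x = 'N[mu]_p%:E[EFin \o h] `^ p)%E.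
Proof. by rewrite poweR_Lnorm. Qed.

Lemma in_Lfun (h : T -> R) : measurable_fun [set: T] h ->
  (\int[mu]_x abs_pow h x < +oo)%E -> h \in Lfun mu p%:E.
Proof.
move=> mh hoo; apply/andP; split; rewrite inE/=; first exact: mh.
by move: hoo; rewrite integral_abs_pow => /(lty_poweRy p_neq0).
Qed.

Lemma Lspace_norm_pow (u : LspaceType mu p1) :
  ((`|u| `^ p)%:E = \int[mu]_x abs_pow (lp_repr u) x)%E.
Proof.
rewrite integral_abs_pow -poweR_EFin lp_normrE; congr poweR.
exact: (finite_norm_fine (lp_repr u)).
Qed.

Lemma lp_repr_lin a (u v : LspaceType mu p1) :
  {ae mu, forall x, lp_repr (a *: u + v) x = a * lp_repr u x + lp_repr v x}.
Proof.
have -> : a *: u + v = lp_class (a *: lp_repr u + lp_repr v).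
  by rewrite lp_classD lp_classZ !lp_reprK.
by apply: filterS (lp_classK (a *: lp_repr u + lp_repr v)) => x /= /(_ I) ->.
Qed.

Lemma lp_repr0 : {ae mu, forall x, lp_repr (0 : LspaceType mu p1) x = 0}.
Proof.
by apply: filterS (lp_classK (0 : LfunType mu p1)) => x /= /(_ I) ->.
Qed.

End Lspace_representatives.

Section change_of_variables.
Context d (T : measurableType d) (R : realType).
Variables (mu : {measure set T -> \bar R}) (E : set T) (f : T -> R).
Hypothesis mE : measurable E.
Hypothesis Eoo : (mu E < +oo)%E.
Hypothesis mf : measurable_fun [set: T] f.
Hypothesis fU : uniform_on mu E f.

Lemma ae_uniform_on (Q : R -> Prop) :
  {ae lebesgue01 R, forall t, Q t} -> {ae mu, forall x, E x -> Q (f x)}.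
Proof.
move=> [N [mN N0 QN]]; exists (E `&` f @^-1` N); split.
- by apply: measurableI => //; rewrite -[_ @^-1` _]setTI; exact: mf.
- by rewrite fU// N0 mule0.
- move=> x /= /not_implyP[Ex nQ]; split => //; exact: QN.
Qed.

(** On [E] the measure agrees with its restriction to [E], whose image by [f] is
    the uniform measure scaled by the measure of [E]. *)
Lemma integral_uniform_on (g : R -> \bar R) :
  measurable_fun [set: R] g -> (forall t, 0 <= g t)%E ->
  (\int[mu]_(x in E) g (f x) = mu E * \int[lebesgue01 R]_t g t)%E.
Proof.
move=> mg g0.
have Efin : mu E \is a fin_num by rewrite ge0_fin_numE.
pose muE := mrestr mu mE.
have mgf : measurable_fun [set: T] (g \o f) by exact: measurableT_comp.
have -> : (\int[mu]_(x in E) g (f x) = \int[muE]_(x in E) g (f x))%E.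
  by apply: eq_measure_integral => A mA AE; rewrite /muE/= /mrestr setIidl.
have -> : (\int[muE]_(x in E) g (f x) = \int[muE]_x g (f x))%E.
  apply: (ge0_eq_integral_ae (g := g \o f)) => //.
    by move=> x; exact: g0.
  exists (~` E); split; first exact: measurableC.
    by rewrite /muE/= /mrestr setICl measure0.
  by move=> x /=; apply: contra_not => Ex _.
pose f' : T -> measurableTypeR R := f.
have mf' : measurable_fun [set: T] f' by [].
have -> : (\int[muE]_x g (f x) = \int[pushforward muE f']_t g t)%E.
  by rewrite (ge0_integral_pushforward mf').
pose c := NngNum (fine_ge0 (measure_ge0 mu E)).
rewrite (eq_measure_integral (mscale c (lebesgue01 R))); last first.
  move=> S mS _; rewrite /pushforward/= /mscale/= fineK//.
  by rewrite -fU// /muE /mrestr setIC.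
by rewrite ge0_integral_mscale//= fineK.
Qed.

End change_of_variables.

Section isometry.
Context d (T : measurableType d) (R : realType) (J : choiceType).
Variables (mu : {measure set T -> \bar R}) (p : R) (p1 : (1 <= p%:E)%E).
Variables (E : J -> set T) (f : J -> T -> R).
Hypothesis E_fp : forall j, finite_positive mu (E j).
Hypothesis E_ad : forall i j, i <> j -> mu (E i `&` E j) = 0%E.
Hypothesis E_max : forall A, measurable A -> (mu A < +oo)%E ->
  (forall j, mu (A `&` E j) = 0%E) -> mu A = 0%E.
Hypothesis f_unif : forall j,
  [/\ measurable_fun [set: T] (f j), uniform_on mu (E j) (f j) &
      factors_on mu (E j) (f j)].

Local Notation L01 := (LspaceType (lebesgue01 R) p1).

Let p_neq0 : p != 0.
Proof. by rewrite gt_eqF// (lt_le_trans ltr01). Qed.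

Let mE j : measurable (E j). Proof. by have [] := E_fp j. Qed.

(* the weight that compensates for the measure of [E j]: see [m_pow] *)
Let m j : R := fine (mu (E j)) `^ (- p^-1).

Let mu_gt0 j : 0 < fine (mu (E j)).
Proof. by have [_ E0 Eoo] := E_fp j; rewrite fine_gt0// E0. Qed.

Let m_gt0 j : 0 < m j. Proof. by rewrite powR_gt0. Qed.

Let m_pow j : m j `^ p = (fine (mu (E j)))^-1.
Proof. by rewrite -powRrM mulNr mulVf// powR_inv1// ltW. Qed.

(** [y] lists the restrictions of [h] to the sets [E j], each transported to the unit
    interval and renormalized. *)
Definition glues (h : T -> R) (y : J -> L01) : Prop :=
  forall j, {ae mu, forall x, E j x -> h x = m j * lp_repr (y j) (f j x)}.

Lemma integral_glued j (h : T -> R) (k : R -> R) :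
  measurable_fun [set: T] h -> measurable_fun [set: R] k ->
  {ae mu, forall x, E j x -> h x = m j * k (f j x)} ->
  (\int[mu]_(x in E j) abs_pow p h x = \int[lebesgue01 R]_t abs_pow p k t)%E.
Proof.
move=> mh mk hk; have [mfj fjU _] := f_unif j; have [_ E0 Eoo] := E_fp j.
have mkf : measurable_fun [set: T] (k \o f j) by exact: measurableT_comp.
transitivity (\int[mu]_(x in E j) ((m j `^ p)%:E * abs_pow p (k \o f j) x))%E.
  apply: ge0_ae_eq_integral => //.
  - by apply: measurable_funTS; exact: measurable_abs_pow.
  - apply: measurable_funTS; apply: emeasurable_funM => //.
    exact: measurable_abs_pow.
  - by move=> x _; exact: abs_pow_ge0.
  - by move=> x _; rewrite mule_ge0 ?abs_pow_ge0// lee_fin powR_ge0.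
  apply: filterS hk => x hkx Ex.
  by rewrite /abs_pow hkx// -EFinM normrM powRM// gtr0_norm.
rewrite ge0_integralZl_EFin ?powR_ge0//.
- rewrite (integral_uniform_on (mE j) Eoo mfj fjU (g := abs_pow p k)).
  + rewrite m_pow muleA -{2}(@fineK _ (mu (E j))) ?ge0_fin_numE//.
    by rewrite -EFinM mulVf ?mul1e// gt_eqF.
  + exact: measurable_abs_pow.
  + exact: abs_pow_ge0.
- by move=> x _; exact: abs_pow_ge0.
- by apply: measurable_funTS; exact: measurable_abs_pow.
Qed.

Lemma pow_sum_glued (C : set J) (h : T -> R) (y : J -> L01) :
  countable C -> measurable_fun [set: T] h ->
  {ae mu, forall x, abs_pow p h x <> 0%E -> exists2 j, C j & E j x} ->
  glues h y -> (pow_sum p y = \int[mu]_x abs_pow p h x)%E.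
Proof.
move=> cC mh hC hy.
rewrite (@integral_almost_partition _ _ _ _ mu E mE E_ad C)//; last 2 first.
- exact: measurable_abs_pow.
- exact: abs_pow_ge0.
apply: eq_esum => j _; rewrite Lspace_norm_pow.
have my : measurable_fun [set: R] (lp_repr (y j)).
  exact: (@measurable_funPT _ _ (measurableTypeR R) R (lp_repr (y j))).
by rewrite (integral_glued mh my (hy j)).
Qed.


Let u_finite (u : LspaceType mu p1) : (\int[mu]_x abs_pow p (lp_repr u) x < +oo)%E.
Proof. by rewrite -Lspace_norm_pow ltry. Qed.

Let pow_sum_u (u : LspaceType mu p1) (y : J -> L01) : glues (lp_repr u) y ->
  pow_sum p y = (`|u| `^ p)%:E.
Proof.
move=> uy; rewrite Lspace_norm_pow.
have [C cC uC] := integrable_countable_cover mE E_ad E_max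
  (measurable_abs_pow p (measurable_funPT (lp_repr u))) (abs_pow_ge0 p _)
  (u_finite u).
exact: (pow_sum_glued cC).
Qed.

Lemma glues_norm (u : LspaceType mu p1) (y : ellp J L01 p1) :
  glues (lp_repr u) y -> `|y| = `|u|.
Proof.
move=> uy; rewrite ellp_normrE (pow_sum_u uy)/= -powRrM mulfV// powRr1//.
Qed.

Lemma glues_lin a (u u' : LspaceType mu p1) (y y' : ellp J L01 p1) :
  glues (lp_repr u) y -> glues (lp_repr u') y' ->
  glues (lp_repr (a *: u + u')) (a *: y + y').
Proof.
move=> uy uy' j; have [mfj fjU _] := f_unif j.
have ylin := ae_uniform_on (mE j) mfj fjU (lp_repr_lin a (y j) (y' j)).
apply: filterS2 (filterI (uy j) (uy' j)) (filterI (lp_repr_lin a u u') ylin).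
move=> x [ux u'x] [-> ylx] Ex.
rewrite ux// u'x// [lp_repr ((a *: y + y') j) _]ylx//.
by rewrite mulrDr mulrCA.
Qed.

Lemma glues_total (u : LspaceType mu p1) :
  exists y : ellp J L01 p1, glues (lp_repr u) y.
Proof.
have mu_ : measurable_fun [set: T] (lp_repr u) by exact: measurable_funPT.
have [y yP] : {y : J -> L01 & glues (lp_repr u) y}.
  apply: (@choice _ _ (fun j z => {ae mu, forall x, E j x ->
    lp_repr u x = m j * lp_repr (z : L01) (f j x)})) => j.
  have [mfj fjU fjF] := f_unif j.
  have [k mk uk] := fjF _ mu_.
  pose k' t := (m j)^-1 * k t.
  have mk' : measurable_fun [set: R] k' by exact: measurable_funM.
  have uk' : {ae mu, forall x, E j x -> lp_repr u x = m j * k' (f j x)}.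
    by apply: filterS uk => x + Ex => ->//; rewrite /k' mulVKf// gt_eqF.
  have k'oo : (\int[lebesgue01 R]_t abs_pow p k' t < +oo)%E.
    rewrite -(@integral_glued j _ _ mu_ mk' uk').
    apply: le_lt_trans (u_finite u); apply: ge0_subset_integral => //.
    - exact: measurable_abs_pow.
    - by move=> x _; exact: abs_pow_ge0.
  pose z : LfunType (lebesgue01 R) p1 := Lfun_Sub p1
    (@in_Lfun _ (measurableTypeR R) R (lebesgue01 R) p p1 k' mk' k'oo).
  exists (lp_class z).
  apply: filterS2 uk' (ae_uniform_on (mE j) mfj fjU (lp_classK z)) => x ux zx Ex.
  by rewrite ux// zx.
have yoo : (y : J -> L01) \in ellp_pred p (X := L01).
  by rewrite inE/= (pow_sum_u yP) ltry.
by exists (Ellp p1 yoo).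
Qed.

(** Only countably many entries of [y] are nonzero, so that their transports can be
    glued measurably along disjoint parts of the sets [E j]. On the other sets
    [E j] the result vanishes almost everywhere, by almost disjointness. *)
Lemma glues_surj (y : ellp J L01 p1) :
  exists u : LspaceType mu p1, glues (lp_repr u) y.
Proof.
have yoo : (pow_sum p y < +oo)%E by rewrite -ge0_fin_numE ?pow_sum_fin ?pow_sum_ge0.
pose C := [set j | (`|y j| `^ p)%:E != 0%E].
have cC : countable C by apply: countable_esum_support => // j; rewrite lee_fin powR_ge0.
pose D := sole_part E C.
pose g j x := m j * lp_repr (y j) (f j x).
have [h hP] : {h : T -> R & forall x, (forall j, C j -> D j x -> h x = g j x) /\
    (~ (\bigcup_(j in C) D j) x -> h x = 0)}.
  apply: (@choice _ _ (fun x r => (forall j, C j -> D j x -> r = g j x) /\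
    (~ (\bigcup_(j in C) D j) x -> r = 0))) => x.
  have [[j Cj Djx]|nx] := pselect ((\bigcup_(j in C) D j) x).
    exists (g j x); split=> [i Ci [_ Dix]|/(_ (ex_intro2 _ _ j Cj Djx))//].
    by rewrite (Dix j)//; case: Djx.
  by exists 0; split => // j Cj Djx; exfalso; apply: nx; exists j.
have mg j : measurable_fun [set: T] (g j).
  have [mfj _ _] := f_unif j.
  apply: measurable_funM => //.
  apply: (measurableT_comp _ mfj).
  exact: (@measurable_funPT _ _ (measurableTypeR R) R (lp_repr (y j))).
have mh : measurable_fun [set: T] h.
  apply: (measurable_fun_countable_pieces cC (D := D) (g := g)) => //.
  - by move=> j; exact: measurable_sole_part.
  - by move=> j x Cj Djx; exact: (hP x).1.
  - by move=> x; exact: (hP x).2.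
have hy : glues h y.
  move=> j; have [mfj fjU _] := f_unif j.
  have [Cj|/negP] := pselect (C j).
    apply: filterS (ae_sole_part mE E_ad j cC) => x xD Ejx.
    by apply: (hP x).1 => //; exact: xD.
  rewrite negbK eqe => /eqP/powR_eq0_eq0/normr0_eq0 yj0.
  have := ae_uniform_on (mE j) mfj fjU (@lp_repr0 _ _ _ (lebesgue01 R) p p1).
  apply: filterS2 (ae_disjoint mE E_ad j cC) => x xE rx Ejx.
  rewrite yj0 rx// mulr0; apply: (hP x).2 => -[i Ci [Eix _]].
  have ij := xE i Ci Eix Ejx; move: Ci.
  by rewrite ij /C/= yj0 normr0 powR0// eqxx.
have hC : {ae mu, forall x, abs_pow p h x <> 0%E -> exists2 j, C j & E j x}.
  apply: aeW => x; apply: contra_notP => nx.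
  rewrite /abs_pow (hP x).2 ?normr0 ?powR0// => -[j Cj [Ejx _]].
  by apply: nx; exists j.
have hoo : (\int[mu]_x abs_pow p h x < +oo)%E.
  by rewrite -(pow_sum_glued cC mh hC hy).
exists (lp_class (Lfun_Sub p1 (in_Lfun p1 mh hoo))) => j.
apply: filterS2 (hy j) (lp_classK (Lfun_Sub p1 (in_Lfun p1 mh hoo))) => x hx ux Ex.
by rewrite ux// -hx.
Qed.

Lemma isometrically_isomorphic_glues :
  isometrically_isomorphic (LspaceType mu p1) (ellp J L01 p1).
Proof.
apply: (@isometrically_isomorphic_rel R (LspaceType mu p1) (ellp J L01 p1)
  (fun u y => glues (lp_repr u) y)).
- exact: glues_total.
- exact: glues_surj.
- by move=> a u v u' v'; apply: glues_lin.
- by move=> u v; exact: glues_norm.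
Qed.

End isometry.

(** * The measure of a product of sets of measure 1 *)

Section baker_rectangles.
Context (R : realType).
Local Notation RN := {ptws nat -> R}.
Local Notation lambda := (@lebesgue_measure R).

(** Otherwise the sum of the series would be at least 1 everywhere on [D], and so
    would be its integral, which is the first sum. *)
Lemma exists_section_lt1 (D : set R) (C : nat -> set R) (a : nat -> R) :
  measurable D -> lambda D = 1%E -> (forall k, measurable (C k)) ->
  (forall k, 0 <= a k) ->
  (\sum_(k <oo) (a k * fine (lambda (D `&` C k)))%:E < 1)%E ->
  exists2 x, D x & (\sum_(k <oo) (a k * \1_(C k) x)%:E < 1)%E.
Proof.
move=> mD D1 mC a0; apply: contraPP => /forall2NP Dge1.
apply/negP; rewrite -leNgt.
have finI k : lambda (D `&` C k) \is a fin_num.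
  rewrite ge0_fin_numE//; apply: (@le_lt_trans _ _ (lambda D)).
    exact: le_lambdaI.
  by rewrite D1 ltry.
have mf k : measurable_fun D (fun x => (a k * \1_(C k) x)%:E).
  by apply/measurable_EFinP; exact: measurable_funM.
have f0 k x : (0 <= (a k * \1_(C k) x)%:E)%E by rewrite lee_fin mulr_ge0.
have -> : (\sum_(k <oo) (a k * fine (lambda (D `&` C k)))%:E =
    \int[lambda]_(x in D) (\sum_(k <oo) (a k * \1_(C k) x)%:E))%E.
  rewrite integral_nneseries//; apply: eq_eseriesr => k _.
  under eq_integral do rewrite EFinM.
  rewrite ge0_integralZl_EFin//; last first.
    by apply/measurable_EFinP; apply: measurable_indic; exact: mC.
  rewrite integral_indic//; last exact: mC.
  by rewrite (setIC (C k)) EFinM fineK.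
rewrite -D1 -[X in (X <= _)%E]mul1e -integral_cst//.
apply: ge0_le_integral => //.
- by apply: (@ge0_emeasurable_sum _ _ _ D _ xpredT) => k *; [exact: f0|exact: mf].
- by move=> x Dx; have [//|/negP] := Dge1 x; rewrite -leNgt.
Qed.

(** The coordinates of a point outside all cylinders are chosen one at a time,
    keeping below 1 the total measure of the sections of the cylinders
    at the coordinates chosen so far. If the point were in the k-th cylinder, the
    section of the latter would have measure 1 after [N k] choices. *)
Lemma rect_not_covered (D : nat -> set R) (A : nat -> nat -> set R)
    (N : nat -> nat) :
  (forall n, measurable (D n)) -> (forall n, lambda (D n) = 1%E) ->
  (forall k n, measurable (A k n)) ->
  (\sum_(k <oo) (\prod_(i < N k) fine (lambda (D i `&` A k i)))%:E < 1)%E ->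
  exists2 x : nat -> R, rect D x &
    forall k, exists2 i, (i < N k)%N & ~ A k i (x i).
Proof.
move=> mD D1 mA S1.
pose C k n := if (n < N k)%N then A k n else [set: R].
have mC k n : measurable (C k n) by rewrite /C; case: ifP.
(* measure of the section of the k-th cylinder after n choices, if it is not empty *)
pose tail k n := \prod_(n <= i < N k) fine (lambda (D i `&` A k i)).
have tail_ge0 k n : 0 <= tail k n by apply: prodr_ge0 => i _; rewrite fine_ge0.
have tailS k n : tail k n = fine (lambda (D n `&` C k n)) * tail k n.+1.
  rewrite /C /tail; case: ltnP => nN; first by rewrite big_ltn.
  by rewrite setIT D1 mul1r !big_geq// ltnW.
(* [w k] records whether the point chosen so far is still in the k-th cylinder. *)
pose S (w : nat -> R) n := (\sum_(k <oo) (w k * tail k n)%:E)%E.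
pose next (w : nat -> R) n x k := w k * \1_(C k n) x.
have [F FP] : {F : nat * (nat -> R) -> R & forall nw,
    (forall k, 0 <= nw.2 k) -> (S nw.2 nw.1 < 1)%E ->
    D nw.1 (F nw) /\ (S (next nw.2 nw.1 (F nw)) nw.1.+1 < 1)%E}.
  apply: (@choice _ _ (fun nw x => (forall k, 0 <= nw.2 k) ->
    (S nw.2 nw.1 < 1)%E ->
    D nw.1 x /\ (S (next nw.2 nw.1 x) nw.1.+1 < 1)%E)) => -[n w] /=.
  have [w0|] := pselect (forall k, 0 <= w k); last by exists 0.
  have [Swn|] := pselect (S w n < 1)%E; last by exists 0.
  have [||k|k||x Dx Sx] := @exists_section_lt1 (D n) (C^~ n)
      (fun k => w k * tail k n.+1).
  - exact: mD.
  - exact: D1.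
  - exact: mC.
  - exact: mulr_ge0.
  - apply: le_lt_trans Swn; rewrite /S; apply: lee_nneseries => k *.
      by rewrite lee_fin; apply: mulr_ge0; [exact: mulr_ge0|exact: fine_ge0].
    by rewrite lee_fin [tail k n]tailS (mulrC (fine _) (tail _ _)) mulrA.
  exists x => _ _; split => //; apply: le_lt_trans Sx.
  apply: lee_nneseries => k *; first by rewrite lee_fin !mulr_ge0.
  by rewrite /next mulrAC.
pose w := fix w n := if n is m.+1 then next (w m) m (F (m, w m)) else fun=> 1.
pose x n := F (n, w n).
have w0 n k : 0 <= w n k by elim: n => [|n IH]//=; rewrite /next mulr_ge0.
have Sw n : (S (w n) n < 1)%E.
  elim: n => [|n IH]; last by have [_] := FP (n, w n) (w0 n) IH.
  apply: le_lt_trans S1; apply: lee_nneseries => k *.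
    by rewrite lee_fin mulr_ge0.
  by rewrite mul1r /tail big_mkord.
exists x => [n|k]; first by have [] := FP (n, w n) (w0 n) (Sw n).
apply: contrapT => /forall2NP xA.
have wk1 n : w n k = 1.
  elim: n => [//|n IH]; rewrite /= /next IH mul1r indicE mem_set//.
  rewrite /C; case: ifPn => // nN; have [/negP|/contrapT//] := xA n.
  by rewrite nN.
have := Sw (N k); apply/negP; rewrite -leNgt /S.
rewrite (@nneseriesD1 _ _ k)//; last by move=> j _; rewrite lee_fin mulr_ge0.
rewrite wk1 mul1r /tail big_geq// leeDl//.
by apply: nneseries_ge0 => j *; rewrite lee_fin mulr_ge0 ?tail_ge0.
Qed.

(** Inside the rectangle [D], every factor has measure at most 1, so partial products
    only overestimate; a covering rectangle can be enlarged to a cylinder at an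
    arbitrarily small cost, and cylinders of total measure less than 1 do not
    cover. *)
Lemma baker_outer_rect (D : nat -> set R) :
  (forall n, measurable (D n)) -> (forall n, lambda (D n) = 1%E) ->
  baker_outer (rect D) = 1%E.
Proof.
move=> mD D1.
have pD n : partial_vol D n = 1.
  by rewrite /partial_vol big1// => i _; rewrite D1.
have cD : partial_vol D @ \oo --> (1 : R).
  by have -> : partial_vol D = fun=> 1 by [exact/funext]; exact: cvg_cst.
have vD : vol_finite D by split => // [n|]; [rewrite D1 ltry|exact: cvgP cD].
apply/eqP; rewrite eq_le; apply/andP; split.
  (* [D] covers itself; the other rectangles of the cover are empty. *)
  apply: ereal_inf_lbound.
  exists (fun k => if k is 0%N then D else fun=> set0).
    split => [[|k]//|x Dx]; first exact: vol_finite0.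
    by exists 0%N.
  rewrite nneseries_recl//=; last first.
    by move=> [|k] _; rewrite lee_fin vol_ge0//; exact: vol_finite0.
  rewrite [vol D](cvg_lim _ cD)// eseries0 ?adde0// => -[|k]// _ _.
  by rewrite vol0.
apply: le_ereal_inf_tmp => _ [A [vA DA] <-].
apply/lee_addgt0Pr => e e0; rewrite leNgt; apply/negP => Ae1.
have [N NP] : {N : nat -> nat & forall k,
    \prod_(i < N k) fine (lambda (D i `&` A k i)) <= vol (A k) + e / (2 ^ k.+1)%:R}.
  apply: (@choice _ _ (fun k n => \prod_(i < n) fine (lambda (D i `&` A k i)) <=
      vol (A k) + e / (2 ^ k.+1)%:R)) => k.
  have [mA Aoo cA] := vA k.
  have : vol (A k) < vol (A k) + e / (2 ^ k.+1)%:R.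
    by rewrite ltrDl divr_gt0// ltr0n expn_gt0.
  move=> /(cvgr_le _ cA) [n _ /(_ n (leqnn n)) /= vn].
  exists n; apply: le_trans vn; apply: ler_prod => i _.
  rewrite fine_ge0//=.
  have DAi : (lambda (D i `&` A k i) <= lambda (A k i))%E.
    by rewrite setIC; exact: le_lambdaI.
  apply: fine_le => //; rewrite ge0_fin_numE//; exact: le_lt_trans DAi _.
have [||k n||x Dx xA] := @rect_not_covered D A N.
- exact: mD.
- exact: D1.
- by have [mA _ _] := vA k.
- apply: le_lt_trans Ae1.
  apply: (le_trans _ (epsilon_trick _ _ (ltW e0))); last first.
    by move=> k; rewrite lee_fin vol_ge0.
  apply: lee_nneseries => k *.
    by rewrite lee_fin prodr_ge0// => i _; exact: fine_ge0.
  by rewrite -EFinD lee_fin.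
by have [k _ Akx] := DA _ Dx; have [i _] := xA k; exact.
Qed.
End baker_rectangles.

(** * Countably generated diffuse measures *)

Section countably_generated_diffuse.
Context d (T : measurableType d) (R : realType).
Variables (mu : {measure set T -> \bar R}) (B : nat -> set T).

(** The hypothesis on cells excludes atoms of finite measure; the family [Q] makes the number of copies of the
    Lebesgue space equal to the continuum rather than bounded by it. *)
Theorem Lspace_isometric_ellp (p : R) (p1 : (1 <= p%:E)%E) (J : choiceType)
    (Q : R -> set T) :
  measurable = <<s range B>> -> setI_closed (range B) -> range B setT ->
  (forall E x, measurable E -> (mu E < +oo)%E ->
    mu (E `&` [set y | forall n, (y \in B n) = (x \in B n)]) = 0%E) ->
  (forall r, finite_positive mu (Q r)) ->
  (forall r s, r <> s -> mu (Q r `&` Q s) = 0%E) ->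
  ([set: J] #= [set: R])%card ->
  isometrically_isomorphic (LspaceType mu p1)
    (ellp J (LspaceType (lebesgue01 R) p1) p1).
Proof.
move=> B_gen BI BT cell0 Qfp Qad JR.
have [E [E_fp E_ad E_max]] := exists_maximal_family B_gen BI BT Qfp Qad JR.
have [f fP] := choice (fun j => let: And3 mE E0 Eoo := E_fp j in
  exists_uniformization B_gen cell0 mE E0 Eoo).
exact: (isometrically_isomorphic_glues p1 E_fp E_ad E_max fP).
Qed.
End countably_generated_diffuse.

(** * The case of Baker's measure *)

Section baker_space.
Context (R : realType).
Local Notation RN := {ptws nat -> R}.
Local Notation lambda := (@lebesgue_measure R).
Local Notation mu := (@baker_measure R).

Lemma open_cylinder i (S : set R) : open S -> open [set x : RN | S (x i)].
Proof.
move=> oS; have ci : continuous (fun x : RN => x i) by exact: proj_continuous.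
by move/continuousP : ci => /(_ S oS).
Qed.

Lemma measurable_cylinder i (S : set R) : open S ->
  measurable ([set x | S (x i)] : set (RN_borel R)).
Proof. by move=> oS; apply: sub_sigma_algebra; exact: open_cylinder. Qed.

Lemma measurable_box s : measurable (box s : set (RN_borel R)).
Proof.
elim: s => [|[i [q r]] s IHs].
  by rewrite (_ : box [::] = setT) //; apply/seteqP; split.
rewrite (_ : box _ = [set x | `]ratr q, ratr r[%classic (x i)] `&` box s).
  by apply: measurableI => //; apply: measurable_cylinder; exact: interval_open.
apply/seteqP; split => [x sx|x [ix sx] t].
  split; first by have := sx (i, (q, r)) (mem_head _ _); rewrite /= in_itv.
  by move=> t ts; apply: sx; rewrite in_cons ts orbT.
rewrite inE => /predU1P[->|/sx//].
by move: ix; rewrite /= in_itv.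
Qed.

(** Integers that encode no list give the whole space, which is a box too. *)
Definition nth_box (n : nat) : set (RN_borel R) :=
  if @unpickle (seq (nat * (rat * rat)))%type n is Some s then box s else setT.

Lemma nth_boxE (s : seq (nat * (rat * rat))) : nth_box (pickle s) = box s.
Proof. by rewrite /nth_box pickleK. Qed.

Lemma boxI s t : box s `&` box t = box (s ++ t) :> set RN.
Proof.
apply/seteqP; split => [x [sx tx] u|x st].
  by rewrite mem_cat => /orP[/sx|/tx].
by split => u us; apply: st; rewrite mem_cat us ?orbT.
Qed.

Lemma box_nil : box [::] = [set: RN].
Proof. by apply/seteqP; split. Qed.

Lemma range_nth_box : range nth_box = range (@box R).
Proof.
apply/seteqP; split => [_ [n _ <-]|_ [s _ <-]]; last first.
  by exists (pickle s) => //; exact: nth_boxE.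
rewrite /nth_box; case: unpickle => [s|]; first by exists s.
by exists [::] => //; exact: box_nil.
Qed.

Lemma measurable_nth_box :
  measurable = <<s range nth_box>> :> set (set (RN_borel R)).
Proof.
rewrite range_nth_box; apply/seteqP; split; last first.
  apply: smallest_sub; first exact: sigma_algebra_measurable.
  by move=> _ [s _ <-]; exact: measurable_box.
apply: smallest_sub; first exact: smallest_sigma_algebra.
move=> O oO; rewrite (_ : O = \bigcup_(s in [set s | box s `<=` O]) box s).
  apply: (@countable_bigcup_measurable _ (g_sigma_algebraType (range (@box R)))).
    exact: countableP.
  by move=> s _; apply: sub_sigma_algebra; exists s.
apply/seteqP; split => [x Ox|x [s sO sx]]; last exact: sO.
by have [s sx sO] := open_box oO Ox; exists s.
Qed.

(** Boxes separate the points, but to get null cells it is enough that they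
    separate the values of one coordinate. *)
Lemma box_separates (x y : RN) :
  (forall n, (y \in nth_box n) = (x \in nth_box n)) -> y 0%N = x 0%N.
Proof.
move=> xy.
have xbox q r : ratr q < x 0%N < ratr r -> ratr q < y 0%N < ratr r.
  move=> qxr; have : (x : RN) \in box [:: (0%N, (q, r))].
    by rewrite inE => t; rewrite inE => /eqP ->.
  rewrite -nth_boxE -xy nth_boxE inE => /(_ (0%N, (q, r)) (mem_head _ _)).
  by [].
have [||//] := ltgtP (y 0%N) (x 0%N).
- move=> /rat_in_itvoo[q]; rewrite in_itv/= => /andP[yq qx].
  have /rat_in_itvoo[r] : x 0%N < x 0%N + 1 by rewrite ltrDl.
  rewrite in_itv/= => /andP[xr _].
  have /andP[qy _] : ratr q < y 0%N < ratr r by apply: xbox; rewrite qx.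
  by have := lt_trans yq qy; rewrite ltxx.
- move=> /rat_in_itvoo[r]; rewrite in_itv/= => /andP[xr ry].
  have /rat_in_itvoo[q] : x 0%N - 1 < x 0%N by rewrite ltrBlDr ltrDl.
  rewrite in_itv/= => /andP[_ qx].
  have /andP[_ yr] : ratr q < y 0%N < ratr r by apply: xbox; rewrite qx.
  by have := lt_trans ry yr; rewrite ltxx.
Qed.

(** Cutting one factor of a rectangle down to a point makes the volume vanish. *)
Lemma baker_outer_slice (E : set RN) (c : R) : (baker_outer E < +oo)%E ->
  baker_outer (E `&` [set y | y 0%N = c]) = 0%E.
Proof.
move=> Eoo.
have [A [vA EA]] : exists A, baker_cover E A.
  apply: contrapT => nA; move: Eoo.
  rewrite /baker_outer (_ : baker_cover E = set0); last first.
    by apply/seteqP; split => // A cA; apply: nA; exists A.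
  by rewrite image_set0 ereal_inf0 ltxx.
have vC k := vol_finite_cut_factor 0 (vA k) (measurable_set1 c).
apply/eqP; rewrite eq_le baker_outer_ge0 andbT.
apply: ereal_inf_lbound; exists (fun k => cut_factor (A k) 0 [set c]).
  split => [k|y [/EA[k _ Aky] y0]]; first exact: vC.
  exists k => // n; rewrite /cut_factor; case: eqP => [n0|_]; last exact: Aky.
  by split; [exact: Aky|rewrite n0].
apply: eseries0 => k _ _.
rewrite [vol _](cvg_lim _ (cvg_cut_factor (i := 0) (vA k) (measurable_set1 c)))//.
have [mAk _ _] := vA k.
rewrite (_ : lambda _ = 0%E) ?mul0r//.
apply: (@subset_measure0 _ _ _ lambda _ [set c]) => //.
- by apply: measurableI => //; exact: mAk.
- exact: lebesgue_measure_set1.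
Qed.

(** The sides of unit cubes indexed by the reals: the n-th side depends on
    whether the n-th rational exceeds [r], so that distinct reals give disjoint
    cubes. *)
Definition cube_side (r : R) (n : nat) : set R :=
  if unpickle n is Some q then
    if r < ratr q then `]1, 2[%classic else `]0, 1[%classic
  else `]0, 1[%classic.

Lemma cube_sideP r n :
  cube_side r n = `]1, 2[%classic \/ cube_side r n = `]0, 1[%classic.
Proof.
by rewrite /cube_side; case: unpickle => [q|]; [case: ifP => _; [left|right]|right].
Qed.

Lemma lebesgue_cube_side r n : lambda (cube_side r n) = 1%E.
Proof.
have [->|->] := cube_sideP r n; rewrite lebesgue_measure_itv/= lte_fin.
  by rewrite ltr1n -EFinB; congr EFin; ring.
by rewrite ltr01 sube0.
Qed.

Lemma open_cube_side r n : open (cube_side r n).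
Proof. by have [->|->] := cube_sideP r n; exact: interval_open. Qed.

Lemma measurable_rect_cube_side r : measurable (rect (cube_side r) : set (RN_borel R)).
Proof.
rewrite (_ : rect _ = \bigcap_n [set x | cube_side r n (x n)]).
  apply: bigcapT_measurable => n; apply: measurable_cylinder; exact: open_cube_side.
by apply/seteqP; split => x; [move=> rx n _; exact: rx|move=> rx n; exact: rx].
Qed.

Lemma rect_cube_side_disjoint r s : r < s -> rect (cube_side r) `&` rect (cube_side s) = set0.
Proof.
move=> /rat_in_itvoo[q]; rewrite in_itv/= => /andP[rq qs].
apply/seteqP; split => // x [/(_ (pickle q)) + /(_ (pickle q))].
rewrite /cube_side pickleK rq ltNge (ltW qs)/= !in_itv/= => /andP[x1 _] /andP[_].
by rewrite ltNge (ltW x1).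
Qed.

End baker_space.

Theorem corollary1p1 (R : realType) (p : R) (p1 : (1 <= p%:E)%E)
  (J : choiceType) (J_continuum : ([set: J] #= [set: R])%card) :
  isometrically_isomorphic
    (LspaceType (@baker_measure R) p1)
    (ellp J (LspaceType (lebesgue01 R) p1) p1).
Proof.
apply: (@Lspace_isometric_ellp _ _ _ _ (@nth_box R) _ _ _
  (fun r => rect (cube_side r))) J_continuum.
- exact: measurable_nth_box.
- rewrite range_nth_box => _ _ [s _ <-] [t _ <-].
  by exists (s ++ t) => //; rewrite boxI.
- by rewrite range_nth_box; exists [::] => //; exact: box_nil.
- move=> E x mE Eoo; apply/eqP; rewrite eq_le measure_ge0 andbT.
  rewrite -[leRHS](baker_outer_slice (x 0%N) Eoo).
  by apply: le_baker_outer => y [Ey xy]; split => //; exact: box_separates.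
- have cube1 r : baker_outer (rect (cube_side r)) = 1%E.
    apply: baker_outer_rect => n; last exact: lebesgue_cube_side.
    by have [->|->] := cube_sideP r n; exact: measurable_itv.
  move=> r; split; first exact: measurable_rect_cube_side.
    by rewrite -[X in (_ < X)%E]/(baker_outer (rect (cube_side r))) cube1 lte_fin.
  by rewrite -[X in (X < _)%E]/(baker_outer (rect (cube_side r))) cube1 ltry.
- move=> r s /eqP; rewrite neq_lt => /orP[rs|sr].
    by rewrite rect_cube_side_disjoint// measure0.
  by rewrite setIC rect_cube_side_disjoint// measure0.
Qed.
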